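(* Let $d\ge2$ and let $S\subset\mathbb{R}^d$ be a well-distributed and separated set. Let $K\subset\mathbb{R}^d$ be a bounded convex set, symmetric about the origin and with non-empty interior. (i) Suppose that there are $C>0$ and a convex increasing function $\gamma:[0,\infty)\to\mathbb{R}$ with $\gamma(0)=0$ such that $$\left|\int_{\partial K}e^{-2\pi i x\cdot\xi}\,d\sigma_K(x)\right|\le C\gamma(|\xi|^{-1})\quad\text{for all }\xi\in\mathbb{R}^d\setminus\{0\},$$ where $\sigma_K$ is the Lebesgue (surface) measure on $\partial K$. Then $\Delta_K(S)$ is not separated. (ii) With no further assumption on $K$, the set $\Delta_K(\rho S)$ is not separated for almost every $\rho\in SO(d)$.
   Context: For a bounded convex set $K\subset\mathbb{R}^d$, symmetric about the origin and with non-empty interior, $\|\cdot\|_K$ is the norm induced by $K$ (the norm whose unit ball is $K$, up to boundary points), and the $K$-distance set of $E\subset\mathbb{R}^d$ is $\Delta_K(E)=\{\|x-y\|_K: x,y\in E\}\subset\mathbb{R}$. A set $S\subset\mathbb{R}^d$ is well-distributed if there exists $C>0$ such that every cube of side-length $C$ contains at least one element of $S$. A subset $A$ of a Euclidean space $\mathbb{R}^n$ (in particular $\mathbb{R}^d$ or $\mathbb{R}$) is separated if there exists $c>0$ such that $|a-a'|\ge c$ for all distinct $a,a'\in A$. ''Almost every $\rho\in SO(d)$'' is with respect to Haar measure, and $\rho S=\{\rho x: x\in S\}$. *)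

(* Defs.v *)
From HB Require Import structures.
From mathcomp Require Import all_boot all_order all_algebra.
From mathcomp Require Import complex.
From mathcomp Require Import all_classical all_reals all_analysis.

Set Implicit Arguments.
Unset Strict Implicit.
Unset Printing Implicit Defensive.

Import Order.TTheory GRing.Theory Num.Theory.
Import numFieldNormedType.Exports.

Local Open Scope classical_set_scope.
Local Open Scope ring_scope.

(* R^d is 'rV[R]_d. Its library norm `|x| is the sup norm, which gives the
   usual topology and the usual bounded sets; metric notions use [l2norm]. *)
Section euclidean.
Context {R : realType} {d : nat}.
Implicit Types (x y : 'rV[R]_d) (A S : set 'rV[R]_d).

Definition dotv x y : R := \sum_(i < d) x 0 i * y 0 i.

Definition l2norm x : R := Num.sqrt (dotv x x).

Definition diameter A : \bar R :=
  ereal_sup [set (l2norm (x - y))%:E | x in A & y in A].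

Definition boundary A : set 'rV[R]_d := closure A `\` A°.

(* The cubes are closed and axis-parallel; other conventions only change C. *)
Definition well_distributed S :=
  exists2 C : R, 0 < C &
    forall a : 'rV[R]_d, exists2 x, S x & forall i, a 0 i <= x 0 i <= a 0 i + C.

End euclidean.

Definition separated_for {R : realType} {V : zmodType} (N : V -> R)
    (A : set V) :=
  exists2 c : R, 0 < c & forall a a', A a -> A a' -> a <> a' -> c <= N (a - a').

Section K_distance.
Context {R : realType} {d : nat}.
Implicit Types (K E : set 'rV[R]_d).

Definition normK K (x : 'rV[R]_d) : R :=
  inf [set t : R | 0 < t /\ [set t *: y | y in K] x].

Definition distance_set K E : set R := [set normK K (x - y) | x in E & y in E].

End K_distance.

(* Volume of the unit ball of R^n: V_n = (2 pi / n) V_(n-2). *)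
Fixpoint unit_ball_volume (R : realType) (n : nat) : R :=
  match n with
  | 0%N => 1
  | 1%N => 2
  | m.+2 => 2 * pi / m.+2%:R * unit_ball_volume R m
  end.

Section hausdorff.
Context {R : realType} {d : nat} (s : nat).
Local Notation E := 'rV[R]_d.
Local Open Scope ereal_scope.

(* Volume of the s-dimensional ball of diameter [diameter U]; the case of set0
   only matters for s = 0. *)
Definition hausdorff_weight (U : set E) : \bar R :=
  if U == set0 then 0
  else (unit_ball_volume R s * (fine (diameter U) / 2) ^+ s)%:E.

Definition hausdorff_content (delta : R) (A : set E) : \bar R :=
  ereal_inf [set \sum_(k <oo) hausdorff_weight (U k) |
    U in [set U : (set E)^nat | A `<=` \bigcup_k U k /\
                                forall k, diameter (U k) <= delta%:E]].

(* With this normalisation it is the Lebesgue measure of R^s on s-dimensional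
   subspaces, and the surface measure on hypersurfaces when s = d - 1. *)
Definition hausdorff (A : set E) : \bar R :=
  ereal_sup [set hausdorff_content delta A | delta in [set x : R | (0 < x)%R]].

Lemma unit_ball_volume_ge0 n : (0 <= unit_ball_volume R n)%R.
Proof.
suff [] : (0 <= unit_ball_volume R n)%R /\ (0 <= unit_ball_volume R n.+1)%R.
  by [].
elim: n => [|n [IH1 IH2]]; first by split => /=.
by split => //; rewrite /= mulr_ge0// divr_ge0// mulr_ge0// pi_ge0.
Qed.

Lemma diameter_ge0 (U : set E) : U !=set0 -> 0 <= diameter U.
Proof.
move=> [x Ux]; apply: (@le_trans _ _ (l2norm (x - x))%:E).
  by rewrite lee_fin sqrtr_ge0.
by apply: ereal_sup_ubound; exists x => //; exists x.
Qed.

Lemma hausdorff_weight_ge0 U : 0 <= hausdorff_weight U.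
Proof.
rewrite /hausdorff_weight; case: ifPn => // /set0P U0.
rewrite lee_fin mulr_ge0 ?unit_ball_volume_ge0// exprn_ge0// divr_ge0//.
by rewrite fine_ge0// diameter_ge0.
Qed.

Lemma hausdorff_content_ge0 delta A : 0 <= hausdorff_content delta A.
Proof.
apply: le_ereal_inf_tmp => x [U _ <-].
by apply: nneseries_ge0 => k _ _; exact: hausdorff_weight_ge0.
Qed.

Lemma hausdorff_content0 delta : hausdorff_content delta set0 = 0.
Proof.
apply/eqP; rewrite eq_le hausdorff_content_ge0 andbT.
apply: ereal_inf_lbound; exists (fun=> set0).
  split=> [//|k]; rewrite /diameter.
  rewrite (_ : [set _ | _ in _ & _ in _] = set0) ?ereal_sup0 ?leNye//.
  by rewrite -subset0 => z [].
by rewrite eseries0// => k _ _; rewrite /hausdorff_weight eqxx.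
Qed.

Lemma le_hausdorff_content delta :
  {homo hausdorff_content delta : A B / A `<=` B >-> A <= B}.
Proof.
move=> A B AB; apply/ereal_inf_le_tmp => x [U [BU dU] <-].
by exists U => //; split => //; exact: subset_trans AB BU.
Qed.

Lemma hausdorff_content_sigma_subadditive delta :
  sigma_subadditive (hausdorff_content delta).
Proof.
set H := hausdorff_content delta => A.
have H0 B : 0 <= H B := hausdorff_content_ge0 delta B.
have [[i ioo]|] := pselect (exists i, H (A i) = +oo).
  rewrite (eseries_pinfty _ _ ioo) ?leey// => n _.
  by rewrite -ltNye (lt_le_trans _ (H0 _)).
rewrite -forallNE => Aoo.
suff add2e (e : {posnum R}) :
    H (\bigcup_n A n) <= \sum_(i <oo) H (A i) + e%:num%:E.
  by apply/lee_addgt0Pr => _/posnumP[].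
rewrite (le_trans _ (epsilon_trick _ _ _))//.
pose P n (B : (set E)^nat) :=
  (A n `<=` \bigcup_k B k /\ forall k, diameter (B k) <= delta%:E) /\
  \sum_(k <oo) hausdorff_weight (B k) <=
    H (A n) + (e%:num / (2 ^ n.+1)%:R)%:E.
have [G PG] : {G : ((set E)^nat)^nat & forall n, P n (G n)}.
  apply: (@choice _ _ P) => n.
  have en1 : (0 < e%:num / (2 ^ n.+1)%:R :> R)%R by [].
  have Hfin : H (A n) \is a fin_num.
    by rewrite ge0_fin_numE// ltey; apply/eqP/Aoo.
  have [x [B PB <-] xS] := lb_ereal_inf_adherent en1 Hfin.
  by exists B; split => //; exact: ltW.
have w0 x : 0 <= (hausdorff_weight \o uncurry G) x.
  exact: hausdorff_weight_ge0.
apply: (@le_trans _ _ (\esum_(i in setT) (hausdorff_weight \o uncurry G) i)).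
  apply: ereal_inf_lbound => /=.
  have /card_esym/ppcard_eqP[f] := card_nat2.
  exists (uncurry G \o f).
    split=> [t [i _ Ait]|k]; last first.
      by rewrite /=; case: (f k) => a b; exact: (PG a).1.2.
    have [j _ Bijt] := (PG i).1.1 _ Ait.
    by exists (f^-1%FUN (i, j)) => //=; rewrite invK ?inE.
  rewrite -(esum_pred_image (hausdorff_weight \o uncurry G) _ xpredT)//.
    by rewrite [fun=> _]set_true image_eq.
  by rewrite [fun=> _]set_true; exact: inj.
rewrite (_ : esum _ _ = \sum_(i <oo) \sum_(j <oo) hausdorff_weight (G i j)).
  apply: lee_nneseries => [n _ _|n _]; last exact: (PG n).2.
  by apply: nneseries_ge0 => m _ _; exact: (w0 (n, m)).
pose J : nat -> set (nat * nat) := fun i => [set (i, j) | j in setT].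
rewrite (_ : setT = \bigcup_k J k); last first.
  by rewrite predeqE => -[a b]; split => // _; exists a => //; exists b.
rewrite esum_bigcupT//=; last first.
  apply/trivIsetP => i j _ _ ij.
  rewrite predeqE => -[n m] /=; split => //= -[] [_] _ [<-{n} _].
  by move=> [m' _] [] /esym/eqP; rewrite (negbTE ij).
rewrite -(image_id [set: nat]) -fun_true esum_pred_image//; last first.
  by move=> n _; apply: esum_ge0 => m _; exact: w0.
apply: eq_eseriesr => /= j _.
have injj : set_inj (fun=> true) (pair j : nat -> nat * nat).
  by move=> ? ? _ _; exact: (@can_inj _ _ _ snd).
rewrite -(esum_pred_image
  (hausdorff_weight \o uncurry G) (pair j) predT _ injj).
  by congr esum; rewrite predeqE => -[a b]; split; move=> [i _ <-]; exists i.
by move=> n _; exact: (w0 (j, n)).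
Qed.

Lemma hausdorff_ge0 A : 0 <= hausdorff A.
Proof.
apply: (@le_trans _ _ (hausdorff_content 1 A)).
  exact: hausdorff_content_ge0.
by apply: ereal_sup_ubound; exists 1%R => //=.
Qed.

Lemma hausdorff0 : hausdorff set0 = 0.
Proof.
apply/eqP; rewrite eq_le hausdorff_ge0 andbT.
by apply: ge_ereal_sup => x [delta _ <-]; rewrite hausdorff_content0.
Qed.

Lemma le_hausdorff : {homo hausdorff : A B / A `<=` B >-> A <= B}.
Proof.
move=> A B AB; apply: ge_ereal_sup => x [delta delta0 <-].
apply: (@le_trans _ _ (hausdorff_content delta B)).
  exact: le_hausdorff_content.
by apply: ereal_sup_ubound; exists delta.
Qed.

Lemma hausdorff_sigma_subadditive : sigma_subadditive hausdorff.
Proof.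
move=> A; apply: ge_ereal_sup => x [delta delta0 <-].
apply: (le_trans (hausdorff_content_sigma_subadditive delta A)).
apply: lee_nneseries => [n _ _|n _]; first exact: hausdorff_content_ge0.
by apply: ereal_sup_ubound; exists delta.
Qed.

HB.instance Definition _ := isOuterMeasure.Build R E hausdorff
  hausdorff0 hausdorff_ge0 le_hausdorff hausdorff_sigma_subadditive.

End hausdorff.

Definition hausdorff_outer (R : realType) (d s : nat) :
    {outer_measure set 'rV[R]_d -> \bar R} := @hausdorff R d s.

Section surface_fourier.
Context {R : realType} {d : nat}.

(* A measure on the Caratheodory-measurable subsets of R^d, which include the
   Borel sets; the measure sigma_K is its restriction to [boundary K]. *)
Definition surface_measure :
    {measure set (caratheodory_type (hausdorff_outer R d d.-1)) -> \bar R} :=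
  (hausdorff_outer R d d.-1 :
     set (caratheodory_type (hausdorff_outer R d d.-1)) -> \bar R).

Definition expi (t : R) : R[i] := (cos t +i* sin t)%C.

Definition surface_integral (D : set 'rV[R]_d) (f : 'rV[R]_d -> R[i]) : R[i] :=
  ((\int[surface_measure]_(x in D) complex.Re (f x)) +i*
   (\int[surface_measure]_(x in D) complex.Im (f x)))%C.

Definition surface_fourier (K : set 'rV[R]_d) (xi : 'rV[R]_d) : R[i] :=
  surface_integral (boundary K) (fun x => expi (- (2 * pi * dotv x xi))).

End surface_fourier.

Section rotations.
Context {R : realType} {d : nat}.

Definition SO : set 'M[R]_d := [set A | A *m A^T = 1%:M /\ \det A = 1].

(* Points are row vectors, so the matrix rho acts by x |-> x *m rho^T. *)
Definition rotate (rho : 'M[R]_d) (S : set 'rV[R]_d) : set 'rV[R]_d :=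
  [set x *m rho^T | x in S].

Definition borel_mx := g_sigma_algebraType (@open 'M[R]_d).

(* Normalised Haar measure of SO(d), as a Borel measure on matrices. *)
Definition is_haar_SO (mu : probability borel_mx R) :=
  mu SO = 1%E /\
  forall (rho : 'M[R]_d) (A : set borel_mx), SO rho -> measurable A ->
    mu [set (rho *m B : borel_mx) | B in (A : set 'M[R]_d)] = mu A.

End rotations.

(* Main.v *)
(* Let N be the norm of K and suppose Delta_K(S) is c-separated. At a point p
   where the graph of N is touched from above by a paraboloid (such p are dense,
   by maximising N - A |x - u|^2), N is differentiable with gradient w. Taking
   y in S near T p and letting T tend to infinity, N(y - x) - N(y - x') tends to
   w.(x' - x), so w.(x - x') is 0 or at least c in absolute value for x, x' in S.
   Since S is well distributed, the vectors v in S - S with w.v = 0 span the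
   hyperplane orthogonal to w, with a uniform bound on their length; hence such
   functionals w are determined up to scaling by their close approximations, and
   up to normalisation there are only countably many of them.

   (ii) For a fixed gradient w of N, if Delta_K(rho S) is separated then w rho is
   such a functional for S. So w rho lies in a countable set, and the rotations
   mapping w to a given vector form a Haar-null set.

   (i) By compactness every point of the boundary {N = 1} lies on one of the
   countably many hyperplanes {w.x = 1}. As the boundary has positive and finite
   surface measure, one of these hyperplanes has positive measure, so by Wiener's
   argument the Fourier transform of the surface measure does not tend to 0 along
   multiples of w. But convexity and gamma(0) = 0 give
   gamma(1/|xi|) <= gamma(1)/|xi| for |xi| >= 1. *)

Require Import Defs.
From mathcomp Require Import all_boot all_order all_algebra.
From mathcomp Require Import complex ring lra zify.
From mathcomp Require Import all_classical all_reals all_analysis measurable_realfun.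
Import Order.TTheory GRing.Theory Num.Theory.
Import numFieldNormedType.Exports.
Local Open Scope classical_set_scope.
Local Open Scope ring_scope.

Set Implicit Arguments.
Unset Strict Implicit.
Unset Printing Implicit Defensive.

(** * Touching paraboloids *)

Section dotv_theory.
Context {R : realType} {d : nat}.
Implicit Types (x y z : 'rV[R]_d) (t : R).

Lemma dotvC x y : dotv x y = dotv y x.
Proof. by apply: eq_bigr => i _; rewrite mulrC. Qed.

Lemma dotvDl x y z : dotv (x + y) z = dotv x z + dotv y z.
Proof. by rewrite -big_split; apply: eq_bigr => i _; rewrite mxE mulrDl. Qed.

Lemma dotvZl t x y : dotv (t *: x) y = t * dotv x y.
Proof. by rewrite mulr_sumr; apply: eq_bigr => i _; rewrite mxE mulrA. Qed.

Lemma dotvDr x y z : dotv x (y + z) = dotv x y + dotv x z.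
Proof. by rewrite dotvC dotvDl !(dotvC x). Qed.

Lemma dotvZr t x y : dotv x (t *: y) = t * dotv x y.
Proof. by rewrite dotvC dotvZl dotvC. Qed.

Lemma dotvNl x y : dotv (- x) y = - dotv x y.
Proof. by rewrite -scaleN1r dotvZl mulN1r. Qed.

Lemma dotvNr x y : dotv x (- y) = - dotv x y.
Proof. by rewrite dotvC dotvNl dotvC. Qed.

Lemma dotvBl x y z : dotv (x - y) z = dotv x z - dotv y z.
Proof. by rewrite dotvDl dotvNl. Qed.

Lemma dotvBr x y z : dotv x (y - z) = dotv x y - dotv x z.
Proof. by rewrite dotvDr dotvNr. Qed.

Lemma le_coord_norm x i : `|x 0 i| <= `|x|.
Proof.
rewrite [leRHS]/Num.norm/= mx_normrE.
by apply/bigmax_geP; right; exists (0, i).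
Qed.

Lemma norm_le_coord x t : 0 <= t -> (forall i, `|x 0 i| <= t) -> `|x| <= t.
Proof.
move=> t0 xt; rewrite /Num.norm/= mx_normrE; apply/bigmax_leP; split => //.
by move=> [i j] _ /=; rewrite ord1.
Qed.

Lemma ler_norm_dotv x y : `|dotv x y| <= d%:R * `|x| * `|y|.
Proof.
apply: (le_trans (ler_norm_sum _ _ _)).
apply: (@le_trans _ _ (\sum_(i < d) `|x| * `|y|)).
  by apply: ler_sum => i _; rewrite normrM ler_pM// le_coord_norm.
by rewrite sumr_const card_ord -mulrA mulr_natl.
Qed.

Lemma dotvv_ge0 x : 0 <= dotv x x.
Proof. by apply: sumr_ge0 => i _; rewrite -expr2 sqr_ge0. Qed.

Lemma sqr_norm_le_dotvv x : `|x| ^+ 2 <= dotv x x.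
Proof.
have [->|x0] := eqVneq `|x| 0; first by rewrite expr0n dotvv_ge0.
have [[i j]/= xij] := mx_norm_neq0 x0.
rewrite (_ : `|x| = `|x i j|)// ord1 -normrX ger0_norm ?sqr_ge0//.
rewrite /dotv (bigD1 j)//= -expr2 lerDl.
by apply: sumr_ge0 => k _; rewrite -expr2 sqr_ge0.
Qed.

Lemma dotvv_eq0 x : (dotv x x == 0) = (x == 0).
Proof.
apply/eqP/eqP => [xx0|->]; last first.
  by rewrite /dotv big1// => i _; rewrite mxE mul0r.
apply/eqP; rewrite -normr_eq0 -sqrf_eq0 eq_le sqr_ge0 andbT.
by rewrite (le_trans (sqr_norm_le_dotvv x))// xx0.
Qed.

Lemma dotvv_gt0 x : x != 0 -> 0 < dotv x x.
Proof. by move=> x0; rewrite lt_def dotvv_ge0 dotvv_eq0 x0. Qed.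

Lemma norm_le_l2norm x : `|x| <= l2norm x.
Proof.
rewrite -(@ler_pXn2r _ 2)// ?nnegrE ?sqrtr_ge0//.
by rewrite sqr_sqrtr ?dotvv_ge0// sqr_norm_le_dotvv.
Qed.

Lemma l2norm_le_norm x : l2norm x <= d%:R * `|x|.
Proof.
have nx0 : 0 <= d%:R * `|x| by rewrite mulr_ge0.
rewrite -(@ler_pXn2r _ 2)// ?nnegrE ?sqrtr_ge0//.
rewrite sqr_sqrtr ?dotvv_ge0// (le_trans (ler_norm _))//.
rewrite (le_trans (ler_norm_dotv x x))// exprMn -mulrA -expr2.
rewrite ler_wpM2r ?sqr_ge0// -natrX ler_nat.
by case: (d) => // n; rewrite expnS expn1 leq_pmulr.
Qed.

Lemma l2normZ t x : l2norm (t *: x) = `|t| * l2norm x.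
Proof.
by rewrite /l2norm dotvZl dotvZr mulrA -expr2 sqrtrM ?sqr_ge0// sqrtr_sqr.
Qed.

Lemma continuous_dotv (T : topologicalType) (f g : T -> 'rV[R]_d) :
  continuous f -> continuous g -> continuous (fun s => dotv (f s) (g s)).
Proof.
move=> cf cg s; apply: cvg_big => [|i _]; first exact: add_continuous.
apply: cvgM.
- exact: (continuous_comp (cf s) (@coord_continuous _ _ _ 0 i (f s))).
- exact: (continuous_comp (cg s) (@coord_continuous _ _ _ 0 i (g s))).
Qed.

Lemma le_lipschitz_continuous (f : 'rV[R]_d -> R) L :
  (forall x y, `|f x - f y| <= L * `|x - y|) -> continuous f.
Proof.
have M0 : 0 < `|L| + 1 by rewrite ltr_wpDl.
move=> fL x; apply/(@cvgrPdist_le _ _ _ (nbhs x) (nbhs_filter x)) => e e0.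
apply/nbhs_ballP.
exists (e / (`|L| + 1)); first by rewrite /= divr_gt0.
move=> y; rewrite mx_norm_ball /ball_/= => /ltW xy.
apply: (le_trans (fL _ _)).
apply: (@le_trans _ _ ((`|L| + 1) * `|x - y|)).
  by rewrite ler_wpM2r// (le_trans (ler_norm L))// lerDl.
by rewrite mulrC -ler_pdivlMr.
Qed.

Lemma continuous_dotvl y : continuous (fun x => dotv x y).
Proof.
apply: (@le_lipschitz_continuous _ (d%:R * `|y|)) => x z.
by rewrite -dotvBl (le_trans (ler_norm_dotv _ _))// mulrAC.
Qed.

End dotv_theory.

(** * Norms equivalent to the sup norm, and the slopes of paraboloids touching them *)

Section gauge.
Context {R : realType} {d : nat}.
Implicit Types (x y u h w : 'rV[R]_d) (N : 'rV[R]_d -> R) (S : set 'rV[R]_d).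

Definition equivalent_norm N (a b : R) :=
  [/\ forall x y, N (x + y) <= N x + N y,
      forall t x, N (t *: x) = `|t| * N x,
      0 < a & forall x, a * `|x| <= N x <= b * `|x|].

Definition dense_within (C : R) S := forall a, exists2 x, S x & `|x - a| <= C.

Definition gapped (c : R) S w := forall x x', S x -> S x' ->
  dotv w (x - x') != 0 -> c <= `|dotv w (x - x')|.

Section norm_theory.
Context (N : 'rV[R]_d -> R) (a b : R).
Hypothesis NP : equivalent_norm N a b.

Lemma gaugeD x y : N (x + y) <= N x + N y.
Proof. by case: NP => + _ _ _; apply. Qed.

Lemma gaugeZ t x : N (t *: x) = `|t| * N x.
Proof. by case: NP => _ + _ _; apply. Qed.

Lemma gaugeN x : N (- x) = N x.
Proof. by rewrite -scaleN1r gaugeZ normrN1 mul1r. Qed.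

Lemma gauge0 : N 0 = 0.
Proof. by rewrite -(scale0r 0) gaugeZ normr0 mul0r. Qed.

Lemma gauge_le x : N x <= b * `|x|.
Proof. by case: NP => _ _ _ /(_ x)/andP[]. Qed.

Lemma gauge_ge x : a * `|x| <= N x.
Proof. by case: NP => _ _ _ /(_ x)/andP[]. Qed.

Lemma gauge_gt0 x : x != 0 -> 0 < N x.
Proof.
case: NP => _ _ a0 _ x0; apply: lt_le_trans (gauge_ge x).
by rewrite mulr_gt0// normr_gt0.
Qed.

Lemma gauge_lipschitz x y : `|N x - N y| <= b * `|x - y|.
Proof.
rewrite ler_norml; apply/andP; split.
  rewrite lerBrDl addrC -lerBrDl opprK.
  apply: (@le_trans _ _ (N x + N (y - x))).
    by rewrite -[X in N X <= _](subrK x) addrC (le_trans (gaugeD _ _)) // addrC.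
  by rewrite lerD2l distrC gauge_le.
rewrite lerBlDl (le_trans _ (lerD (lexx _) (gauge_le _)))//.
by rewrite -[X in N X <= _](subrK y) addrC gaugeD.
Qed.

Lemma continuous_gauge : continuous N.
Proof. exact: (le_lipschitz_continuous gauge_lipschitz). Qed.

(* A maximum point [p] of [N x - A |x - u|^2] is close to [u], and there a
   paraboloid touches the graph of [N] from above. *)
Lemma gauge_le_paraboloid u (e : R) : 0 < e -> exists p w B,
  [/\ `|p - u| <= e, 0 <= B &
      forall h, N (p + h) <= N p + dotv w h + B * dotv h h].
Proof.
(* With this coefficient the penalty [A |x - u|^2] outweighs the Lipschitz bound on [N] outside the
   ball of radius [e], so a maximum over that compact ball is global. *)
move=> e0; set A := `|b| / e.
have A0 : 0 <= A by rewrite divr_ge0// ltW.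
pose f x := N x - A * dotv (x - u) (x - u).
pose D := [set x | `|x - u| <= e].
have cD : compact D.
  apply: bounded_closed_compact.
    exists (`|u| + e); split; first exact: num_real.
    move=> M uM x /= xe; rewrite -(subrK u x).
    by rewrite (le_trans (ler_normD _ _))// (le_trans _ (ltW uM))// addrC lerD2l.
  rewrite (_ : D = (fun x => `|x - u|) @^-1` [set t | t <= e])//.
  apply: closed_comp; last exact: closed_le.
  move=> x _; apply: (@le_lipschitz_continuous _ _ _ 1) => y z.
  by rewrite mul1r (le_trans (ler_dist_dist _ _))// opprB addrA subrK.
have cf : continuous f.
  have cu : continuous (fun x => x - u).
    move=> x; apply: (@cvgB _ _ _ _ (nbhs_filter x) id (cst u)).
      exact: cvg_id.
    exact: cvg_cst.
  move=> x; apply: (@cvgB _ _ _ _ (nbhs_filter x) N).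
    exact: continuous_gauge.
  apply: (@cvgM _ _ _ (nbhs_filter x) (cst A)); first exact: cvg_cst.
  exact: (continuous_dotv cu cu).
have Du : D u by rewrite /D/= subrr normr0 ltW.
have [p] := EVT_max_rV (ex_intro _ u Du) cD (continuous_subspaceT cf).
rewrite inE => Dp pmax.
have fp x : f x <= f p.
  have [xD|xD] := pselect (D x); first by apply: pmax; rewrite inE.
  apply: (@le_trans _ _ (f u)); last by apply: pmax; rewrite inE.
  have /ltW xue : e < `|x - u| by rewrite ltNge; apply/negP.
  rewrite /f subrr (_ : dotv 0 0 = 0) ?mulr0 ?subr0; last first.
    by apply/eqP; rewrite dotvv_eq0.
  rewrite lerBlDr -lerBlDl (le_trans (ler_norm _))//.
  rewrite (le_trans (gauge_lipschitz _ _))//.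
  apply: (@le_trans _ _ (A * `|x - u| ^+ 2)); last first.
    by rewrite ler_wpM2l// sqr_norm_le_dotvv.
  rewrite expr2 mulrA ler_wpM2r// (le_trans (ler_norm _))//.
  by rewrite /A -mulrA ler_peMr// mulrC ler_pdivlMr// mul1r.
(* The slope is the gradient of [A |x - u|^2] at [p]; maximality at [p + h], with the square
   expanded, is the claim. *)
exists p, ((2 * A) *: (p - u)), A; split => // h.
have := fp (p + h); rewrite /f -addrA (addrC h) addrA.
move: (p - u) => q; rewrite dotvZl dotvDl !dotvDr (dotvC h q) => H.
lra.
Qed.

(** Convexity supplies the lower bound: [2 N p <= N (p + h) + N (p - h)], where the last term is
    bounded by the hypothesis at [- h]. Thus [N] is differentiable at [p] with gradient [w]. *)
Lemma gauge_paraboloid p w (B : R) h :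
  (forall h, N (p + h) <= N p + dotv w h + B * dotv h h) ->
  `|N (p + h) - N p - dotv w h| <= B * dotv h h.
Proof.
move=> H.
have Hh := H h.
have Hn := H (- h).
have : 2 * N p <= N (p + h) + N (p - h).
  rewrite -[2 in leLHS](@ger0_norm _ 2)// -gaugeZ (le_trans _ (gaugeD _ _))//.
  by rewrite addrACA subrr addr0 scaler_nat mulr2n.
move: Hn; rewrite !dotvNr dotvNl opprK => Hn H2.
by rewrite ler_norml; apply/andP; split; lra.
Qed.

(** Both parts let [t] tend to 0 in the estimate along [t *: h]: homogeneity in the direction [p]
    gives Euler's identity, and subadditivity in the direction [x] gives the inequality. *)
Lemma paraboloid_slope p w (B : R) : 0 <= B ->
  (forall h, N (p + h) <= N p + dotv w h + B * dotv h h) ->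
  dotv w p = N p /\ forall x, dotv w x <= N x.
Proof.
move=> B0 H.
have small (x y : R) : 0 <= y -> (forall t : R, 0 < t -> x <= t * y) -> x <= 0.
  move=> y0 xy; apply/ler_addgt0Pr => e e0.
  have y1 : 0 < y + 1 by rewrite ltr_wpDl.
  have := xy (e / (y + 1)) (divr_gt0 e0 y1); rewrite add0r => /le_trans; apply.
  by rewrite -mulrA ger_pMr// mulrC ler_pdivrMr// mul1r lerDl.
have bnd h (t : R) : 0 < t ->
    `|N (p + t *: h) - N p - t * dotv w h| <= t * (t * (B * dotv h h)).
  move=> t0; have := gauge_paraboloid (t *: h) H.
  rewrite !dotvZl !dotvZr => /le_trans; apply.
  by rewrite le_eqVlt; apply/orP; left; apply/eqP; ring.
split; last first.
  move=> x; rewrite -subr_le0; apply: (small _ (B * dotv x x)).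
    by rewrite mulr_ge0// dotvv_ge0.
  move=> t t0; rewrite -(ler_pM2l t0).
  have := bnd x t t0; have := gaugeD p (t *: x); rewrite gaugeZ gtr0_norm//.
  by move=> H1; rewrite ler_norml => /andP[H2 _]; lra.
apply/eqP; rewrite eq_sym -subr_eq0 -normr_le0.
apply: (small _ (B * dotv p p)); first by rewrite mulr_ge0// dotvv_ge0.
move=> t t0; rewrite -(ler_pM2l t0) -[X in X * `|_|](gtr0_norm t0) -normrM.
have := bnd p t t0; rewrite -[X in X + _ *: _]scale1r -scalerDl gaugeZ.
rewrite (gtr0_norm (addr_gt0 ltr01 t0)).
by congr (`|_| <= _); ring.
Qed.

(* For [y] in [S] near [T p] one has [N (y - x) - N (y - x')] equal to
   [dotv w (x' - x)] up to [O (1 / T)]. *)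
Lemma slope_gapped S (C c : R) p w (B : R) : dense_within C S -> 0 <= B ->
  (forall x x' y y', S x -> S x' -> S y -> S y' ->
    N (x - y) != N (x' - y') -> c <= `|N (x - y) - N (x' - y')|) ->
  (forall h, N (p + h) <= N p + dotv w h + B * dotv h h) ->
  gapped c S w.
Proof.
move=> dS B0 sepS H x x' Sx Sx'; set s := dotv w _ => s0.
(* A bound for [dotv h h] when [h = y - T *: p - z], since [|h| <= C + |z|]. *)
pose Q (z : 'rV[R]_d) := d%:R * (C + `|z|) ^+ 2.
have Q0 z : 0 <= Q z by rewrite mulr_ge0// sqr_ge0.
rewrite leNgt; apply/negP => sc.
pose M := B * (Q x + Q x'); have M0 : 0 <= M by rewrite mulr_ge0// addr_ge0.
(* An error below [m] excludes both cases: equal distances would give [|s| < |s|], and distances at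
   least [c] apart would give [c < |s| + (c - |s|)]. *)
pose m := Num.min `|s| (c - `|s|).
have m0 : 0 < m by rewrite lt_min normr_gt0 s0 subr_gt0.
pose T := (M + 1) / m.
have T0 : 0 < T by rewrite divr_gt0// ltr_wpDl.
have MTm : M / T < m.
  by rewrite ltr_pdivrMr// /T mulrCA divff ?gt_eqF// mulr1 ltrDl.
have [y Sy yC] := dS (T *: p).
have est z : `|N (y - z) - T * N p - dotv w (y - T *: p - z)| <= B * Q z / T.
  pose h := y - T *: p - z.
  have -> : y - z = T *: (p + T^-1 *: h).
    by rewrite scalerDr scalerA divff ?gt_eqF// scale1r /h addrAC [RHS]addrC subrK.
  rewrite gaugeZ (gtr0_norm T0) -/h.
  have := gauge_paraboloid (T^-1 *: h) H.
  rewrite dotvZl !dotvZr => Hh.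
  have -> : T * N (p + T^-1 *: h) - T * N p - dotv w h =
      T * (N (p + T^-1 *: h) - N p - T^-1 * dotv w h).
    by rewrite !mulrBr mulrA divff ?gt_eqF// mul1r.
  rewrite normrM gtr0_norm// -ler_pdivlMl// (le_trans Hh)//.
  rewrite [leRHS](_ : _ = B * (T^-1 * (T^-1 * Q z))); last by ring.
  rewrite !ler_wpM2l ?invr_ge0 ?(ltW T0)//.
  rewrite (le_trans (ler_norm _))// (le_trans (ler_norm_dotv _ _))//.
  rewrite -mulrA ler_wpM2l// -expr2 ler_pXn2r ?nnegrE ?addr_ge0//.
    by rewrite (le_trans (ler_normB _ _))// lerD2r.
  by rewrite (le_trans _ yC).
have := est x; have := est x'.
rewrite !(dotvBr w _ x) !(dotvBr w _ x').
set Y := dotv w _ => e1 e2.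
have {e1 e2} : `|N (y - x) - N (y - x') + s| <= M / T.
  rewrite /M mulrDr mulrDl /s dotvBr.
  move: e1 e2; rewrite !ler_norml => /andP[a1 a2] /andP[b1 b2].
  by apply/andP; split; lra.
have [->|/(sepS _ _ _ _ Sy Sy Sx Sx')] := eqVneq (N (y - x)) (N (y - x')).
  rewrite subrr add0r => /le_lt_trans/(_ MTm).
  by rewrite /m lt_min ltxx.
set D := N _ - N _ => cD DM.
have : `|D| - `|s| <= `|D + s|.
  by rewrite -[X in _ - X]normrN (le_trans (lerB_dist _ _))// opprK.
move=> /le_trans/(_ DM)/le_lt_trans/(_ MTm); rewrite /m lt_min => /andP[_].
by rewrite ltrD2r => /(le_lt_trans cD); rewrite ltxx.
Qed.

End norm_theory.

End gauge.

(** * Gapped functionals *)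

Section gapped_functionals.
Context {R : realType} {d : nat}.
Implicit Types (x y z u v w : 'rV[R]_d) (S : set 'rV[R]_d).

(* Pigeonhole on points of [S] close to multiples of [z]: [dotv w] takes
   boundedly many values on them, while [dotv z] separates them. *)
Lemma gapped_kernel S (C c M : R) : dense_within C S -> 0 < c -> exists2 L : R,
  0 < L & forall w z, gapped c S w -> `|w| <= M -> dotv w z = 0 -> z != 0 ->
    exists x x', [/\ S x, S x', dotv w (x - x') = 0, dotv z (x - x') != 0 &
      `|x - x'| <= L].
Proof.
move=> dS c0.
have C0 : 0 <= C by have [x _ /(le_trans _)] := dS 0; apply.
have [M0|Mlt0] := leP 0 M; last first.
  by exists 1 => // w z _ wM; have := le_lt_trans wM Mlt0; rewrite normr_lt0.
(* [W] bounds [dotv w] at the points chosen below: they lie within [C] of multiples of [e], where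
   [dotv w] vanishes. *)
pose W := d%:R * M * C; have W0 : 0 <= W by rewrite !mulr_ge0.
(* The spacing of the multiples of [e] exceeds twice the error [d C] of [dotv e] at a chosen point,
   so [dotv e] separates these points. *)
pose B := 2 * (d%:R * C) + 1; have B0 : 0 < B by rewrite ltr_wpDl// !mulr_ge0.
(* Boxes of width [c] covering [[-W, W]]. Among [n + 1] points two share a box, so their values
   under [dotv w] differ by less than [c], hence agree. *)
pose n := (Num.truncn (2 * W / c)).+1.
exists (2 * C + n%:R * B); first by rewrite ltr_wpDl ?mulr_ge0// mulr_gt0.
move=> w z gw wM wz0 z0.
pose e := `|z|^-1 *: z.
have ne : `|e| = 1 by rewrite normrZ normfV normr_id mulVf// normr_eq0.
have we : dotv w e = 0 by rewrite dotvZr wz0 mulr0.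
have ee : 1 <= dotv e e by rewrite (le_trans _ (sqr_norm_le_dotvv e))// ne expr1n.
have [X XP] : {X : 'I_n.+1 -> 'rV[R]_d &
    forall j, S (X j) /\ `|X j - (j%:R * B) *: e| <= C}.
  apply: (@choice _ _ (fun (j : 'I_n.+1) x => S x /\ `|x - (j%:R * B) *: e| <= C)).
  by move=> j; have [x Sx xC] := dS ((j%:R * B) *: e); exists x.
have wX j : `|dotv w (X j)| <= W.
  have [_ Xj] := XP j.
  rewrite -[X j](subrK ((j%:R * B) *: e)) dotvDr dotvZr we mulr0 addr0.
  by rewrite (le_trans (ler_norm_dotv _ _))// /W ler_pM// ?mulr_ge0// ler_wpM2l.
pose F j := (dotv w (X j) + W) / c.
have F0 j : 0 <= F j.
  rewrite divr_ge0 ?(ltW c0)// -lerBlDr sub0r.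
  by have := wX j; rewrite ler_norml => /andP[].
have Fn j : (Num.truncn (F j) < n)%N.
  rewrite /n ltnS le_truncn// ler_wpM2r ?invr_ge0 ?(ltW c0)// (mulr_natl W 2) mulr2n.
  by rewrite lerD2r (le_trans (ler_norm _)).
pose f j := Ordinal (Fn j).
have /injectivePn[j [k jk fjk]] : ~~ injectiveb f.
  apply/negP => /injectiveP /leq_card; rewrite !card_ord.
  by rewrite ltnn.
exists (X j), (X k).
have [SXj Xj] := XP j; have [SXk Xk] := XP k.
split => //.
- apply/eqP/negPn/negP => /(gw _ _ SXj SXk); rewrite leNgt => /negP; apply.
  move/(congr1 val) : fjk => /= fjk.
  have /andP[j1 j2] := truncn_itv (F0 j).
  have /andP[k1 k2] := truncn_itv (F0 k).
  rewrite fjk in j1 j2; rewrite -addn1 natrD in j2 k2.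
  have -> : dotv w (X j - X k) = c * (F j - F k).
    by rewrite dotvBr /F -mulrBl mulrC divfK ?gt_eqF//; ring.
  rewrite normrM gtr0_norm// gtr_pMr// ltr_norml.
  by apply/andP; split; lra.
- suff : dotv e (X j - X k) != 0.
    by apply: contra => /eqP zX; rewrite /e dotvZl zX mulr0.
  rewrite -normr_gt0.
  have -> : X j - X k = ((j%:R - k%:R) * B) *: e +
      ((X j - (j%:R * B) *: e) - (X k - (k%:R * B) *: e)).
    by apply/rowP => i; rewrite !mxE; ring.
  rewrite dotvDr dotvZr dotvBr.
  set p := dotv e (X j - _); set q := dotv e (X k - _).
  have pC : `|p| <= d%:R * C.
    by rewrite (le_trans (ler_norm_dotv _ _))// ne mulr1 ler_wpM2l.
  have qC : `|q| <= d%:R * C.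
    by rewrite (le_trans (ler_norm_dotv _ _))// ne mulr1 ler_wpM2l.
  have jk1 : 1 <= `|j%:R - k%:R : R|.
    wlog : j k jk {fjk SXj SXk Xj Xk p q pC qC} / (k < j)%N.
      move=> H; have [|kj|/val_inj E] := ltngtP k j; first exact: H.
      - by rewrite distrC H// eq_sym.
      - by rewrite E eqxx in jk.
    by move=> kj; rewrite -natrB ?(ltnW kj)// ger0_norm// ler1n subn_gt0.
  have BB : B <= `|(j%:R - k%:R) * B * dotv e e|.
    rewrite !normrM (gtr0_norm B0) (ger0_norm (dotvv_ge0 e)) mulrAC.
    rewrite -[leLHS]mul1r ler_wpM2r ?(ltW B0)//.
    by rewrite -[leLHS]mul1r ler_pM.
  apply: (@lt_le_trans _ _ (B - (d%:R * C + d%:R * C))); first by rewrite /B; lra.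
  rewrite (le_trans _ (lerB_normD _ _))// lerB//.
  by rewrite (le_trans (ler_normB _ _))// lerD.
- have -> : X j - X k = ((j%:R - k%:R) * B) *: e +
      ((X j - (j%:R * B) *: e) - (X k - (k%:R * B) *: e)).
    by apply/rowP => i; rewrite !mxE; ring.
  rewrite (le_trans (ler_normD _ _))// addrC lerD//.
    rewrite (le_trans (ler_normB _ _))// (mulr_natl C 2) mulr2n.
    exact: lerD.
  rewrite normrZ ne mulr1 normrM (gtr0_norm B0) ler_wpM2r ?(ltW B0)//.
  have nj (i : 'I_n.+1) : (i%:R : R) <= n%:R by rewrite ler_nat -ltnS ltn_ord.
  by rewrite ler_norml; apply/andP; split;
     have := nj j; have := nj k; have := ler0n R j; have := ler0n R k; lra.
Qed.

(* The component of [w'] orthogonal to [w] is detected by some bounded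
   [v] in [S - S] with [dotv w v = 0]; then [dotv w' v] equals [dotv (w' - w) v],
   which is nonzero but smaller than the gap. *)
Lemma gapped_colinear S (C c M : R) : dense_within C S -> 0 < c ->
  exists2 e : R, 0 < e & forall w w', gapped c S w -> gapped c S w' ->
    `|w| <= M -> w != 0 -> `|w' - w| < e -> exists t, w' = t *: w.
Proof.
move=> dS c0; have [L L0 HL] := gapped_kernel M dS c0.
have D0 : 0 < d%:R * L + 1 by rewrite ltr_wpDl// mulr_ge0// ltW.
exists (c / (d%:R * L + 1)); first by rewrite divr_gt0.
move=> w w' gw gw' wM w0 ww'.
pose t := dotv w' w / dotv w w; pose z := w' - t *: w.
exists t; apply/eqP; rewrite -subr_eq0; apply/negPn/negP => z0.
have wz : dotv w z = 0.
  by rewrite dotvBr dotvZr /t divfK ?dotvv_eq0// dotvC subrr.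
have [x [x' [Sx Sx' wv zv vL]]] := HL w z gw wM wz z0.
have w'v : dotv w' (x - x') = dotv z (x - x').
  by rewrite dotvBl dotvZl wv mulr0 subr0.
have := gw' _ _ Sx Sx'; rewrite w'v => /(_ zv).
rewrite -w'v -[dotv w' _]subr0 -wv -dotvBl leNgt => /negP; apply.
apply: le_lt_trans (ler_norm_dotv _ _) _.
apply: (@le_lt_trans _ _ (`|w' - w| * (d%:R * L))).
  by rewrite mulrAC mulrC ler_wpM2l// ler_wpM2l.
move: ww'; rewrite ltr_pdivlMr// => /(le_lt_trans _); apply.
by rewrite ler_wpM2l// lerDl.
Qed.

(** A cell of the grid of mesh [e / 2] contains at most one point of [A], so the integer cell
    coordinates give an injection. *)
Lemma discrete_countable (A : set 'rV[R]_d) (e : R) : 0 < e ->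
  (forall v w, A v -> A w -> `|v - w| < e -> v = w) -> countable A.
Proof.
move=> e0 Ae; apply/countable_injP.
pose g v := [ffun i : 'I_d => Num.floor (2 * v 0 i / e)].
exists (pickle \o g) => v w; rewrite !inE => Av Aw /= /(pcan_inj pickleK) gvw.
apply: Ae => //; apply: (@le_lt_trans _ _ (e / 2)); last first.
  by rewrite ltr_pdivrMr// ltr_pMr// ltr1n.
apply: norm_le_coord => [|i]; first by rewrite divr_ge0// ltW.
have /ffunP/(_ i) := gvw; rewrite !ffunE => E.
have /andP[v1 v2] := mem_rg1_floor (2 * v 0 i / e).
have /andP[w1 w2] := mem_rg1_floor (2 * w 0 i / e).
rewrite E in v1 v2.
rewrite !mxE ler_pdivlMr// mulrC -[2]ger0_norm// -normrM.
move: v1 v2 w1 w2; set k := (X in X <= _).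
rewrite !ler_pdivlMr// !ltr_pdivrMr// => v1 v2 w1 w2.
by rewrite ler_norml; apply/andP; split; lra.
Qed.

(** Close elements are proportional, hence equal or opposite; opposite ones are at distance at least
    [2 m]. So [A] is uniformly discrete. *)
Lemma gapped_countable S (C c m M : R) (A : set 'rV[R]_d) :
  dense_within C S -> 0 < c -> 0 < m ->
  (forall w, A w -> [/\ gapped c S w, m <= `|w| & `|w| <= M]) ->
  (forall w t, A w -> A (t *: w) -> `|t| = 1) -> countable A.
Proof.
move=> dS c0 m0 AP AZ; have [e e0 He] := gapped_colinear M dS c0.
apply: (@discrete_countable _ (Num.min e m)).
  by rewrite lt_min e0.
move=> v w Av Aw; rewrite lt_min => /andP[vwe vwm].
have [gv _ _] := AP _ Av; have [gw mw wM] := AP _ Aw.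
have w0 : w != 0 by rewrite -normr_gt0 (lt_le_trans m0).
have [t vtw] := He w v gw gv wM w0 vwe.
have := AZ _ t Aw; rewrite -vtw => /(_ Av).
have [t0|t0] := leP 0 t.
  by rewrite ger0_norm// => t1; rewrite vtw t1 scale1r.
rewrite ltr0_norm// => /eqP; rewrite eqr_oppLR => /eqP t1.
move: vwm; rewrite vtw t1 scaleN1r -opprD normrN -mulr2n normrMn mulr2n => vwm.
exfalso; lra.
Qed.

(** * Gapped functionals supporting the unit ball *)

Section supporting_functionals.
Variables (N : 'rV[R]_d -> R) (a b : R) (S : set 'rV[R]_d) (C c : R).
Hypotheses (NP : equivalent_norm N a b) (dS : dense_within C S) (c0 : 0 < c).
Hypothesis sepS : forall x x' y y', S x -> S x' -> S y -> S y' ->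
  N (x - y) != N (x' - y') -> c <= `|N (x - y) - N (x' - y')|.

(** The gapped elements of the unit ball of the dual norm. *)
Definition gapped_dual : set 'rV[R]_d :=
  [set w | gapped c S w /\ forall x, dotv w x <= N x].

(** Points touched by a paraboloid are dense, and the slope at such a point is gapped and supports
    [N] there. *)
Lemma gapped_dual_near u (e : R) : 0 < e -> exists p w,
  [/\ `|p - u| <= e, gapped_dual w & dotv w p = N p].
Proof.
move=> e0; have [p [w [B [pu B0 H]]]] := gauge_le_paraboloid NP u e0.
have [wp wN] := paraboloid_slope NP B0 H.
by exists p, w; split => //; split => //; exact: (slope_gapped NP dS B0 sepS H).
Qed.

Lemma gapped_dual_bounded w : gapped_dual w -> `|w| <= `|b|.
Proof.
move=> [_ wN]; apply: norm_le_coord => // i.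
have de (t : R) : dotv w (t *: delta_mx 0 i) = t * w 0 i.
  rewrite dotvZr; congr (_ * _); rewrite /dotv (bigD1 i)//= mxE !eqxx mulr1.
  by rewrite big1 ?addr0// => j /negPf ji; rewrite mxE ji andbF mulr0.
have ne : `|delta_mx 0 i : 'rV[R]_d| <= 1.
  apply: norm_le_coord => // j; rewrite mxE eqxx/=.
  by case: eqP => _; rewrite ?normr1 ?normr0.
have H (t : R) : `|t| = 1 -> t * w 0 i <= `|b|.
  move=> t1; rewrite -de (le_trans (wN _))// (le_trans (gauge_le NP _))//.
  rewrite normrZ t1 mul1r (le_trans (ler_norm _))// normrM normr_id.
  by rewrite ler_piMr.
rewrite ler_norml lerNl -mulN1r H ?normrN1//.
by rewrite -[w 0 i]mul1r H ?normr1.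
Qed.

(** The gap condition is closed: each value is 0 or at least [c] in absolute value. *)
Lemma gapped_dual_compact : compact gapped_dual.
Proof.
apply: bounded_closed_compact.
  exists `|b|; split; first exact: num_real.
  by move=> x bx w /gapped_dual_bounded/le_trans; apply; exact: ltW.
rewrite (_ : gapped_dual =
  (\bigcap_(xy in [set xy | S xy.1 /\ S xy.2])
    ([set w | dotv w (xy.1 - xy.2) = 0] `|`
     [set w | c <= `|dotv w (xy.1 - xy.2)|])) `&`
  \bigcap_(x in setT) [set w | dotv w x <= N x]); last first.
  apply/seteqP; split=> w [gw wN]; split.
  - move=> [x y] [/= Sx Sy]; have [->|/(gw _ _ Sx Sy)] := eqVneq (dotv w (x - y)) 0.
      by left.
    by right.
  - by move=> x _; exact: wN.
  - move=> x y Sx Sy wxy; have [|//] := gw (x, y) (conj Sx Sy).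
    by move/eqP; rewrite (negbTE wxy).
  - by move=> x; exact: wN.
apply: closedI; [apply: closed_bigI => xy _|apply: closed_bigI => x _].
  apply: closedU.
    apply: (@closed_comp _ _ (fun w => dotv w (xy.1 - xy.2)) [set t | t = 0]).
      by move=> w _; exact: continuous_dotvl.
    exact: closed_eq.
  apply: (@closed_comp _ _ (fun w => `|dotv w (xy.1 - xy.2)|) [set t | c <= t]).
    move=> w _; apply: (continuous_comp (@continuous_dotvl _ _ (xy.1 - xy.2) w)).
    exact: norm_continuous.
  exact: closed_ge.
apply: (@closed_comp _ _ (fun w => dotv w x) [set t | t <= N x]).
  by move=> w _; exact: continuous_dotvl.
exact: closed_le.
Qed.

(** By compactness some [w] maximises [dotv w u]. A slope [v] at a touching point [p] near [u] has
    [dotv v u >= N u - 2 |b| |p - u|], so the maximum is [N u]. *)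
Lemma gapped_dual_attained u : exists2 w, gapped_dual w & dotv w u = N u.
Proof.
have [p1 [w1 [_ gw1 _]]] := gapped_dual_near u ltr01.
have [w] := EVT_max_rV (ex_intro _ w1 gw1) gapped_dual_compact
  (continuous_subspaceT (@continuous_dotvl _ _ u)).
rewrite inE => gw wmax; exists w => //.
apply/eqP; rewrite eq_le; apply/andP; split; first by case: gw.
apply/ler_addgt0Pr => e e0.
have b0 : 0 < 2 * `|b| + 1 by rewrite ltr_wpDl// mulr_ge0.
have [p [v [pu gv vp]]] := gapped_dual_near u (divr_gt0 e0 b0).
have bpu : `|b| * `|p - u| * 2 <= e.
  rewrite -mulrA (mulrC _ 2) mulrA (mulrC `|b|).
  apply: (@le_trans _ _ ((2 * `|b| + 1) * `|p - u|)).
    by rewrite ler_wpM2r// lerDl.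
  by rewrite mulrC -ler_pdivlMr.
have H1 : N (p - u) <= `|b| * `|p - u|.
  by rewrite (le_trans (gauge_le NP _))// ler_wpM2r// ler_norm.
have H2 : N u <= N p + N (p - u).
  rewrite -(gaugeN NP (p - u)) opprB -[X in N X <= _](subrK p) addrC.
  exact: (le_trans (gaugeD NP _ _)).
have [_ /(_ (p - u))] := gv; rewrite dotvBr vp => H3.
have := wmax v; rewrite inE => /(_ gv) H4.
lra.
Qed.

(** Attaining [N] at a nonzero vector forces dual norm exactly 1. This bounds [|w|] from below and
    makes the ratio of two proportional elements 1 or -1. *)
Lemma gapped_dual_attained_countable :
  countable [set w | gapped_dual w /\ exists2 u, u != 0 & dotv w u = N u].
Proof.
have a0 : 0 < a by case: NP.
have D0 : 0 < d%:R + 1 :> R by rewrite ltr_wpDl.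
apply: (gapped_countable (m := a / (d%:R + 1)) (M := `|b|) dS c0).
- exact: divr_gt0.
- move=> w [gw [u u0 wu]]; split; [by case: gw| |exact: gapped_dual_bounded].
  rewrite ler_pdivrMr// -(@ler_pM2r _ `|u|) ?normr_gt0//.
  apply: (le_trans (gauge_ge NP u)); rewrite -wu (le_trans (ler_norm _))//.
  rewrite (le_trans (ler_norm_dotv _ _))// ler_wpM2r// mulrC ler_wpM2l//.
  by rewrite lerDl.
move=> w t [[_ wN] [u u0 wu]] [[_ twN] [v v0 twv]].
have Nu := gauge_gt0 NP u0; have Nv := gauge_gt0 NP v0.
have t1 : `|t| <= 1.
  have H := twN u; have := twN (- u).
  rewrite dotvNr (gaugeN NP) => H'; rewrite !dotvZl wu in H H'.
  rewrite -(ler_pM2r Nu) mul1r -[X in _ * X](gtr0_norm Nu) -normrM ler_norml.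
  by rewrite H andbT lerNl H'.
apply/eqP; rewrite eq_le t1/=.
have H := wN v; have := wN (- v).
rewrite dotvNr (gaugeN NP) => H'.
have : `|dotv w v| <= N v by rewrite ler_norml H lerNl H'.
rewrite dotvZl in twv.
move=> wv; rewrite -(ler_pM2r Nv) mul1r -[leLHS](gtr0_norm Nv) -{1}twv normrM.
by rewrite ler_wpM2l.
Qed.

End supporting_functionals.
End gapped_functionals.

(** * Hausdorff measures are metric outer measures *)

Section hausdorff_metric.
Context {R : realType} {d : nat} (s : nat).
Local Notation E := 'rV[R]_d.
Implicit Types (A B X U : set E) (x y : E).
Local Open Scope ereal_scope.

Lemma l2norm_le_diameter U x y : U x -> U y -> (l2norm (x - y))%:E <= diameter U.
Proof. by move=> Ux Uy; apply: ereal_sup_ubound; exists x => //; exists y. Qed.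

Lemma diameter_le U (r : R) :
  (forall x y, U x -> U y -> l2norm (x - y) <= r)%R -> diameter U <= r%:E.
Proof.
by move=> Ur; apply: ge_ereal_sup => _ [x Ux [y Uy <-]]; rewrite lee_fin Ur.
Qed.

Lemma hausdorff_weight_le U (r : R) : (0 <= r)%R -> diameter U <= r%:E ->
  hausdorff_weight s U <= (unit_ball_volume R s * (r / 2) ^+ s)%:E.
Proof.
move=> r0 Ur; rewrite /hausdorff_weight; case: ifPn => [_|/set0P U0].
  by rewrite lee_fin mulr_ge0 ?unit_ball_volume_ge0// exprn_ge0// divr_ge0.
have D0 := diameter_ge0 U0.
have Dfin : diameter U \is a fin_num.
  by rewrite ge0_fin_numE// (le_lt_trans Ur)// ltry.
rewrite lee_fin ler_wpM2l ?unit_ball_volume_ge0// lerXn2r ?nnegrE ?divr_ge0//.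
  by rewrite fine_ge0.
by rewrite ler_wpM2r// -lee_fin fineK.
Qed.

Lemma hausdorff_content_antitone A (delta delta' : R) : (delta <= delta')%R ->
  hausdorff_content s delta' A <= hausdorff_content s delta A.
Proof.
move=> dd'; apply: ereal_inf_le_tmp => _ [U [AU dU] <-].
exists U => //; split => // k; apply: le_trans (dU k) _.
by rewrite lee_fin.
Qed.

Lemma hausdorff_content_le A (delta : R) : (0 < delta)%R ->
  hausdorff_content s delta A <= hausdorff s A.
Proof. by move=> d0; apply: ereal_sup_ubound; exists delta. Qed.

Definition apart (e : R) A B :=
  forall x y, A x -> B y -> (e <= l2norm (x - y))%R.

(** A set of diameter at most [delta < e] cannot meet both [A] and [B], so a cover of the union
    splits into a cover of each; discarded members become [set0], of weight 0. *)
Lemma hausdorff_content_apart (delta e : R) A B : (0 <= delta < e)%R ->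
  apart e A B ->
  hausdorff_content s delta A + hausdorff_content s delta B <=
    hausdorff_content s delta (A `|` B).
Proof.
move=> /andP[delta0 deltae] AB; apply: le_ereal_inf_tmp => _ [U [ABU dU] <-].
pose meeting X k := if `[< U k `&` X !=set0 >] then U k else set0.
have meetP X : X `<=` A `|` B -> hausdorff_content s delta X <=
    \sum_(k <oo) hausdorff_weight s (meeting X k).
  move=> XAB; apply: ereal_inf_lbound; exists (meeting X) => //; split=> [x Xx|k].
    have [k _ Ukx] := ABU _ (XAB _ Xx); exists k => //.
    by rewrite /meeting; case: asboolP => // H; exfalso; apply: H; exists x.
  rewrite /meeting; case: asboolP => _; first exact: dU.
  by apply: diameter_le.
apply: (le_trans (leeD (meetP A _) (meetP B _))) => //.
rewrite -nneseriesD; try by move=> *; exact: hausdorff_weight_ge0.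
apply: lee_nneseries => [k _ _|k _].
  by rewrite adde_ge0// hausdorff_weight_ge0.
have w0 : hausdorff_weight s (set0 : set E) = 0.
  by rewrite /hausdorff_weight eqxx.
rewrite /meeting.
case: asboolP => [[x [Ux Ax]]|_]; case: asboolP => [[y [Uy By]]|_];
  rewrite ?w0 ?adde0 ?add0e ?hausdorff_weight_ge0//.
have := le_trans (l2norm_le_diameter Ux Uy) (dU k); rewrite lee_fin.
by move=> /(le_trans (AB _ _ Ax By))/(lt_le_trans deltae); rewrite ltxx.
Qed.

(** Contents grow as the scale shrinks, so two scales [r] and [t] can be replaced by a common one
    below [e]. *)
Lemma hausdorff_apart (e : R) A B : (0 < e)%R -> apart e A B ->
  hausdorff s A + hausdorff s B <= hausdorff s (A `|` B).
Proof.
move=> e0 AB; set z := hausdorff s (A `|` B).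
have [->|zoo] := eqVneq z +oo; first by rewrite leey.
have zA : hausdorff s A <= z by apply: le_hausdorff => x; left.
have fin X : hausdorff s X <= z -> hausdorff s X \is a fin_num.
  by move=> Xz; rewrite ge0_fin_numE ?hausdorff_ge0// (le_lt_trans Xz)// ltey.
rewrite addeC -leeBrDr ?fin//.
apply: ge_ereal_sup => _ [r r0 <-]; rewrite leeBrDr ?fin// addeC.
have rB : hausdorff_content s r B \is a fin_num.
  rewrite ge0_fin_numE ?hausdorff_content_ge0//.
  rewrite (le_lt_trans (hausdorff_content_le B r0))// ltey_eq fin//.
  by apply: le_hausdorff => x; right.
rewrite -leeBrDr//; apply: ge_ereal_sup => _ [t t0 <-]; rewrite leeBrDr//.
pose u := Num.min (e / 2)%R (Num.min r t).
have u0 : (0 < u)%R by rewrite !lt_min divr_gt0//= r0.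
apply: (@le_trans _ _ (hausdorff_content s u A + hausdorff_content s u B)).
  by apply: leeD; apply: hausdorff_content_antitone; rewrite !ge_min lexx ?orbT.
apply: le_trans (hausdorff_content_le _ u0).
apply: hausdorff_content_apart AB; rewrite ltW//=.
by rewrite gt_min ltr_pdivrMr// ltr_pMr// ltr1n.
Qed.

(** * Sublevel sets of Lipschitz functions are Caratheodory measurable *)

Section caratheodory_criterion.
Variables (g : E -> R) (L : R).
Hypotheses (L0 : (0 < L)%R)
  (gL : forall x y, (`|g x - g y| <= L * l2norm (x - y))%R).

Lemma hausdorff_level_apart (t t' : R) A B : (t < t')%R ->
  (forall x, A x -> (g x <= t)%R) -> (forall x, B x -> (t' <= g x)%R) ->
  hausdorff s A + hausdorff s B <= hausdorff s (A `|` B).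
Proof.
move=> tt' At Bt; apply: (@hausdorff_apart ((t' - t) / L)).
  by rewrite divr_gt0// subr_gt0.
move=> x y Ax By; rewrite ler_pdivrMr// mulrC.
apply: le_trans (gL x y); rewrite distrC (le_trans _ (ler_norm _))//.
by rewrite lerB ?At ?Bt.
Qed.

Let layer X k := [set x | X x /\ (k.+2%:R^-1 < g x <= k.+1%:R^-1)%R].

Let invS_lt (m n : nat) : (0 < m < n)%N -> (n%:R^-1 < m%:R^-1 :> R)%R.
Proof.
by move=> /andP[m0 mn]; rewrite ltf_pV2 ?ltr_nat// posrE ltr0n// (ltn_trans m0).
Qed.

(** Induction on [m]: the layer being added is kept apart from the level set containing the earlier
    ones by the skipped layer of index [2 m + j]. *)
Let layer_sum_le X j m : \sum_(k < m) hausdorff s (layer X (k.*2 + j).+1) <=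
  hausdorff s [set x | X x /\ ((m.*2 + j).+1%:R^-1 <= g x)%R].
Proof.
elim: m => [|m IH]; first by rewrite big_ord0 hausdorff_ge0.
rewrite big_ord_recr/= (le_trans (leeD IH (lexx _)))// addeC.
apply: (le_trans (@hausdorff_level_apart
    (m.*2 + j).+2%:R^-1 (m.*2 + j).+1%:R^-1 _ _ _ _ _)).
- by apply: invS_lt; rewrite /= ltnS.
- by move=> x [_ /andP[]].
- by move=> x [].
apply: le_hausdorff => x [[Xx /andP[/ltW gx _]]|[Xx gx]]; split => //.
by apply: le_trans gx; rewrite ltW// invS_lt//= doubleS !addSn.
Qed.

Let layer_series_lty X j : hausdorff s X < +oo ->
  \sum_(0 <= k <oo) hausdorff s (layer X (k.*2 + j).+1) < +oo.
Proof.
move=> Xoo; apply: le_lt_trans Xoo; apply: lime_le.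
  by apply: is_cvg_nneseries => k _ _; exact: hausdorff_ge0.
apply: nearW => m; rewrite big_mkord (le_trans (layer_sum_le X j m))//.
by apply: le_hausdorff => x [].
Qed.

Let layer_cover X n : X `&` [set x | 0 < g x]%R `<=`
  [set x | X x /\ ((n.*2 + 0).+2%:R^-1 <= g x)%R] `|`
  ((\bigcup_(k in ~` `I_n) layer X (k.*2 + 0).+1) `|`
   (\bigcup_(k in ~` `I_n) layer X (k.*2 + 1).+1)).
Proof.
move=> x [Xx /= gx].
have [gn|gn] := leP (n.*2 + 0).+2%:R^-1%R (g x); [by left|right].
have gV0 : (0 <= (g x)^-1)%R by rewrite invr_ge0 ltW.
(* Then [1 / (q + 1) < g x <= 1 / q], so [x] lies in the layer of index [q - 1]; the parity of [q]
   selects the family. *)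
pose q := Num.truncn (g x)^-1.
have /andP[q1 q2] := truncn_itv gV0; rewrite -/q in q1 q2.
have qn : (n.*2.+1 < q)%N.
  rewrite /q truncn_ge_nat//; move: gn; rewrite addn0 => gn.
  by rewrite -[leLHS]invrK lef_pV2 ?posrE ?invr_gt0 ?ltr0n// ltW.
have gq : (q.+1%:R^-1 < g x <= q%:R^-1)%R.
  rewrite -[g x]invrK ltf_pV2 ?posrE ?ltr0n ?invr_gt0// q2/=.
  by rewrite lef_pV2 ?posrE ?invr_gt0// ltr0n (leq_ltn_trans _ qn).
have qE : q = (((q - 2)./2).*2 + odd q).+2.
  have : (1 < q)%N by rewrite (leq_trans _ qn).
  by case: (q) => [|[|m]]// _; rewrite subn2/= negbK addnC odd_double_half.
have kn : ~ ((q - 2)./2 < n)%N.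
  apply/negP; rewrite -leqNgt -leq_double.
  by move: qn; rewrite {1}qE; clear; case: (odd q); lia.
move: gq qE kn; case: (odd q) => gq qE kn; [right|left];
  by exists ((q - 2)./2) => //; split => //; rewrite -qE.
Qed.

(* Layers [1 / (k + 2) < g <= 1 / (k + 1)] whose indices have the same parity
   are apart, so the measures of all the layers are summable. *)
Lemma caratheodory_sublevel :
  (hausdorff_outer R d s).-caratheodory [set x | g x <= 0]%R.
Proof.
apply: le_caratheodory_measurable => X.
change (hausdorff s (X `&` [set x | g x <= 0]%R) +
  hausdorff s (X `&` ~` [set x | g x <= 0]%R) <= hausdorff s X).
have [->|Xoo] := eqVneq (hausdorff s X) +oo; first by rewrite leey.
have {}Xoo : hausdorff s X < +oo by rewrite ltey.
have -> : ~` [set x | g x <= 0]%R = [set x | 0 < g x]%R.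
  by apply/seteqP; split=> x /=; [move/negP; rewrite -ltNge|rewrite ltNge => /negP].
(* The part of [X] where [0 < g] is covered by a level set apart from [g <= 0] and by the layers in
   these two tails, which vanish as [n] grows. *)
pose tail j n := \sum_(n <= k <oo) hausdorff s (layer X (k.*2 + j).+1).
have tail0 j : tail j n @[n --> \oo] --> 0.
  apply: (nneseries_tail_cvg (layer_series_lty j Xoo)) => k _.
  exact: hausdorff_ge0.
have step n : hausdorff s (X `&` [set x | g x <= 0]%R) +
    hausdorff s (X `&` [set x | 0 < g x]%R) <=
    hausdorff s X + (tail 0%N n + tail 1%N n).
  have -> : hausdorff s X + (tail 0%N n + tail 1%N n) =
     (tail 0%N n + tail 1%N n) + hausdorff s X by rewrite addeC.
  pose Bn := [set x | X x /\ ((n.*2 + 0).+2%:R^-1 <= g x)%R].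
  apply: (@le_trans _ _ (hausdorff s (X `&` [set x | g x <= 0]%R) +
      (hausdorff s Bn + (tail 0%N n + tail 1%N n)))).
    rewrite leeD2l// (le_trans (le_hausdorff _ (@layer_cover X n)))//.
    apply: le_trans (outer_measureU2 (hausdorff_outer R d s) _ _) _.
    rewrite leeD2l//.
    apply: le_trans (outer_measureU2 (hausdorff_outer R d s) _ _) _.
    by apply: leeD; apply: (outer_measure_sigma_subadditive_tail
      (hausdorff_outer R d s)).
  rewrite addeA addeC leeD2l//.
  apply: (le_trans (@hausdorff_level_apart 0 (n.*2 + 0).+2%:R^-1 _ _ _ _ _)).
  - by rewrite invr_gt0 ltr0n.
  - by move=> x [].
  - by move=> x [].
  by apply: le_hausdorff => x [[]|[]].
have : hausdorff s X + (tail 0%N n + tail 1%N n) @[n --> \oo] -->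
    hausdorff s X + (0 + 0).
  apply: cvgeD; [|exact: cvg_cst|apply: cvgeD => //].
  by rewrite adde0 fin_num_adde_defl.
rewrite !adde0 => lim; rewrite -(cvg_lim _ lim)//.
by apply: lime_ge; [exact: cvgP lim|exact: nearW].
Qed.

End caratheodory_criterion.
End hausdorff_metric.

(** * The unit sphere of a norm has positive finite measure *)

Section hausdorff_unit_sphere.
Context {R : realType}.

Lemma unit_ball_volume_gt0 n : 0 < unit_ball_volume R n.
Proof.
suff [] : 0 < unit_ball_volume R n /\ 0 < unit_ball_volume R n.+1 by [].
elim: n => [|n [IH1 IH2]]; first by split => /=; rewrite ?ltr01 ?ltr0n.
by split => //=; rewrite mulr_gt0// divr_gt0// mulr_gt0// pi_gt0.
Qed.

(** The finite cover is padded by empty sets, of weight 0, to a sequence. *)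
Lemma hausdorff_content_le_card {d : nat} (s : nat) (T : finType)
    (U : T -> set 'rV[R]_d) (A : set 'rV[R]_d) (delta r : R) :
  0 <= r -> r <= delta -> A `<=` \bigcup_i U i ->
  (forall i x y, U i x -> U i y -> l2norm (x - y) <= r) ->
  (hausdorff_content s delta A <=
   (#|T|%:R * (unit_ball_volume R s * (r / 2) ^+ s))%:E)%E.
Proof.
move=> r0 rd AU Ur; set V := unit_ball_volume R s * _.
pose W k := if insub k is Some i then U (enum_val (i : 'I_#|T|)) else set0.
have W0 k : (#|T| <= k)%N -> W k = set0 by move=> Tk; rewrite /W insubN// -leqNgt.
have dW k : (diameter (W k) <= r%:E)%E.
  by apply: diameter_le => x y; rewrite /W; case: insubP => // i _ _; exact: Ur.
apply: (@le_trans _ _ (\sum_(k <oo) hausdorff_weight s (W k))%E).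
  apply: ereal_inf_lbound; exists W => //; split=> [x /AU[i _ Uix]|k].
    exists (enum_rank i) => //; rewrite /W.
    case: insubP => [j _ jE|]; last by rewrite ltn_ord.
    by have -> : j = enum_rank i by [exact: val_inj]; rewrite enum_rankK.
  by rewrite (le_trans (dW k))// lee_fin.
rewrite (nneseries_split _ #|T|); last by move=> k _; exact: hausdorff_weight_ge0.
rewrite [X in (_ + X)%E]eseries0 ?adde0; last first.
  by move=> k Tk _; rewrite W0 /hausdorff_weight ?eqxx.
rewrite add0n big_mkord (le_trans (lee_sum _ (g := fun=> V%:E) _))//.
  by move=> k _; exact: hausdorff_weight_le.
by rewrite sumEFin sumr_const card_ord mulr_natl.
Qed.

(** * The unit sphere has finite measure *)

Section finiteness.
Context {m : nat} (N : 'rV[R]_m.+1 -> R) (a b : R).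
Hypothesis NP : equivalent_norm N a b.

(** The difference splits as [(x - y) / N x] plus [y] times the difference of the inverses of
    [N]. *)
Lemma gauge_radial_lipschitz (x y : 'rV[R]_m.+1) : 1 <= `|x| -> 1 <= `|y| ->
  `|y| <= 1 ->
  `|(N x)^-1 *: x - (N y)^-1 *: y| <= (a^-1 + b / a ^+ 2) * `|x - y|.
Proof.
case: (NP) => _ _ a0 _ x1 y1 y1'.
have Nx : a <= N x by rewrite (le_trans _ (gauge_ge NP x))// ler_peMr// ltW.
have Ny : a <= N y by rewrite (le_trans _ (gauge_ge NP y))// ler_peMr// ltW.
have Nx0 : 0 < N x by exact: lt_le_trans Nx.
have Ny0 : 0 < N y by exact: lt_le_trans Ny.
have -> : (N x)^-1 *: x - (N y)^-1 *: y =
    (N x)^-1 *: (x - y) + ((N y - N x) / (N x * N y)) *: y.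
  apply/rowP => i; rewrite !mxE; field.
  by rewrite ?gt_eqF.
rewrite (le_trans (ler_normD _ _))// [leRHS]mulrDl lerD//.
  rewrite normrZ ler_wpM2r// gtr0_norm ?invr_gt0//.
  by rewrite lef_pV2// posrE.
rewrite normrZ normrM (le_trans (ler_piMr _ y1'))// ?mulr_ge0//.
rewrite mulrAC ler_pM//.
  by rewrite distrC (gauge_lipschitz NP).
rewrite gtr0_norm ?invr_gt0 ?mulr_gt0// lef_pV2 ?posrE ?mulr_gt0 ?exprn_gt0//.
by rewrite expr2 ler_pM// ltW.
Qed.

(* The sphere is covered by the radial images of the cells of a grid of mesh
   [1 / M] on the faces of the unit cube. *)
Lemma hausdorff_unit_sphere_lty : (hausdorff m [set x | N x = 1%R] < +oo)%E.
Proof.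
case: (NP) => _ _ a0 _.
pose Lam := m.+1%:R * (a^-1 + b / a ^+ 2).
have b0 : 0 <= b.
  have := le_trans (gauge_ge NP (const_mx 1)) (gauge_le NP (const_mx 1)).
  have n1 : 0 < `|const_mx 1 : 'rV[R]_m.+1|.
    rewrite normr_gt0; apply/eqP => /rowP/(_ 0)/eqP.
    by rewrite !mxE oner_eq0.
  by rewrite ler_pM2r// => ab; rewrite (le_trans (ltW a0)).
have Lam0 : 0 < Lam.
  by rewrite mulr_gt0// ltr_pwDl ?invr_gt0// divr_ge0// sqr_ge0.
(* A face carries [(3 M) ^ m] cells, with images of diameter at most [Lam / M]; the powers of [M]
   cancel, so the bound does not depend on [delta]. *)
pose B := (#|{: 'I_m.+1 * bool}|%:R * (unit_ball_volume R m * (3 * Lam / 2) ^+ m))%:E.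
apply: (@le_lt_trans _ _ B); last exact: ltry.
apply: ge_ereal_sup => _ [delta /= delta0 <-].
pose M := (Num.truncn (Lam / delta)).+1.
have M0 : 0 < M%:R :> R by rewrite ltr0n.
have MLam : Lam / M%:R <= delta.
  rewrite ler_pdivrMr// mulrC -ler_pdivrMr// ltW//; exact: truncnS_gt.
pose ratio (y : 'rV[R]_m.+1) i j := y 0 j / y 0 i.
(* A cell records a coordinate of largest modulus, its sign, and the grid position of the other
   coordinates relative to it. The shifted ratios lie in [[0, 2]], so the positions are at most
   [2 M], which is below [3 M]. *)
pose U (t : 'I_m.+1 * bool * {ffun 'I_m -> 'I_(3 * M)}) := [set y : 'rV[R]_m.+1 |
  [/\ N y = 1, 0 < (-1) ^+ t.1.2 * y 0 t.1.1, forall j, `|y 0 j| <= `|y 0 t.1.1| &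
   forall j, Num.truncn ((ratio y t.1.1 (lift t.1.1 j) + 1) * M%:R) = t.2 j]].
have Ucover : [set x | N x = 1] `<=` \bigcup_t U t.
  move=> y /= Ny.
  have y0 : `|y| != 0.
    rewrite normr_eq0; apply/eqP => y0; move: Ny.
    by rewrite y0 (gauge0 NP) => /esym/eqP; rewrite oner_eq0.
  have [[i' i]/= iE] := mx_norm_neq0 y0.
  have yi : `|y| = `|y 0 i| by rewrite -(ord1 i').
  have yi0 : y 0 i != 0 by rewrite -normr_eq0 -yi.
  have rat j : `|ratio y i j| <= 1.
    by rewrite normrM normfV ler_pdivrMr ?normr_gt0// mul1r -yi le_coord_norm.
  have tM j : (Num.truncn ((ratio y i (lift i j) + 1) * M%:R) < 3 * M)%N.
    have := rat (lift i j); rewrite ler_norml => /andP[r1 r2].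
    rewrite truncn_lt_nat; last by rewrite mulr_ge0// -lerBlDr sub0r.
    by rewrite natrM ltr_pM2r//; lra.
  exists (i, y 0 i < 0, [ffun j => Ordinal (tM j)]) => //; split => //=.
  - by rewrite -normrEsign normr_gt0.
  - by move=> j; rewrite -yi le_coord_norm.
  - by move=> j; rewrite ffunE.
have Udiam t x y : U t x -> U t y -> l2norm (x - y) <= Lam / M%:R.
  move: t => [[i e] f] [/= Nx xi xj xf] [/= Ny yi yj yf].
  have sgn (z : 'rV[R]_m.+1) : N z = 1 -> 0 < (-1) ^+ e * z 0 i ->
      (forall j, `|z 0 j| <= `|z 0 i|) ->
      let z' := (z 0 i)^-1 *: z in
      [/\ `|z'| = 1, z = (-1) ^+ e *: ((N z')^-1 *: z') & z' 0 i = 1].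
    move=> Nz zi zj z'.
    have zi0 : z 0 i != 0 by apply: contraTneq zi => ->; rewrite mulr0 ltxx.
    have z'i : z' 0 i = 1 by rewrite mxE mulVf.
    split => //.
      apply/eqP; rewrite eq_le; apply/andP; split.
        apply: norm_le_coord => // j; rewrite mxE normrM normfV mulrC.
        by rewrite ler_pdivrMr ?normr_gt0// mul1r.
      by rewrite -[leLHS]normr1 -z'i le_coord_norm.
    rewrite (gaugeZ NP) Nz mulr1 normfV invrK /z' !scalerA.
    have -> : `|z 0 i| = (-1) ^+ e * z 0 i.
      by rewrite -(gtr0_norm zi) normrM normrX normrN1 expr1n mul1r.
    by rewrite mulfK// -expr2 sqrr_sign scale1r.
  have [x1 xE x'i] := sgn x Nx xi xj; have [y1 yE y'i] := sgn y Ny yi yj.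
  rewrite xE yE -scalerBr l2normZ normrX normrN1 expr1n mul1r.
  apply: (le_trans (l2norm_le_norm _)); rewrite -mulrA ler_wpM2l//.
  apply: (le_trans (gauge_radial_lipschitz _ _ _)); rewrite ?x1 ?y1//.
  rewrite ler_wpM2l//; first by rewrite addr_ge0 ?invr_ge0 ?(ltW a0)// divr_ge0// sqr_ge0.
  apply: norm_le_coord => [|k]; first by rewrite invr_ge0 ltW.
  case: (unliftP i k) => [j ->|->]; last first.
    by rewrite mxE x'i mxE y'i subrr normr0 invr_ge0 ltW.
  have := xf j; rewrite -(yf j) => E.
  have rge0 (z : 'rV[R]_m.+1) : (forall j, `|z 0 j| <= `|z 0 i|) ->
      0 <= (ratio z i (lift i j) + 1) * M%:R.
    move=> zj; rewrite mulr_ge0// -lerBlDr sub0r lerNl.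
    rewrite (le_trans (ler_norm _))// normrN normrM normfV.
    have [->|zi0] := eqVneq (z 0 i) 0; first by rewrite normr0 invr0 mulr0.
    by rewrite ler_pdivrMr ?normr_gt0// mul1r.
  have /andP[t1 t2] := truncn_itv (rge0 _ xj).
  have /andP[t3 t4] := truncn_itv (rge0 _ yj).
  rewrite !mxE -(ler_pM2r M0) mulVf ?gt_eqF// -[X in _ * X](gtr0_norm M0) -normrM.
  move: t1 t2 t3 t4; rewrite E; set q := Num.truncn _.
  have -> : q.+1%:R = q%:R + 1 :> R by rewrite natr1.
  rewrite /ratio => t1 t2 t3 t4.
  by rewrite ler_norml; apply/andP; split; lra.
apply: (le_trans (hausdorff_content_le_card m _ MLam Ucover Udiam)).
  by rewrite divr_ge0// ltW.
rewrite lee_fin !card_prod card_ffun !card_ord card_bool natrM natrX -mulrA.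
rewrite ler_wpM2l// mulrCA ler_wpM2l ?unit_ball_volume_ge0//.
rewrite -exprMn natrM le_eqVlt; apply/orP; left; apply/eqP; congr (_ ^+ _).
by field; rewrite ?gt_eqF.
Qed.

End finiteness.

(** Coordinatewise reduction modulo [q + 1] is injective on [A]. *)
Lemma card_window (n Q q : nat) (A : {set {ffun 'I_n -> 'I_Q}}) :
  (forall f g, f \in A -> g \in A -> forall j, (f j - g j <= q)%N) ->
  (#|A| <= q.+1 ^ n)%N.
Proof.
move=> Aq; pose h (f : {ffun 'I_n -> 'I_Q}) : {ffun 'I_n -> 'I_q.+1} :=
  [ffun j => Ordinal (ltn_pmod (f j) (ltn0Sn q))].
have hinj : {in A &, injective h}.
  move=> f g Af Ag /ffunP fg; apply/ffunP => j; apply: val_inj.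
  have := fg j; rewrite !ffunE => /(congr1 val)/= E.
  wlog gf : f g Af Ag {fg} E / (g j <= f j)%N.
    by move=> H; have [/H|/ltnW/H->//] := leqP (g j) (f j); exact.
  apply/eqP; rewrite eqn_leq gf andbT -subn_eq0 -leqn0 leqNgt; apply/negP => fg0.
  have : (q.+1 %| f j - g j)%N by rewrite -eqn_mod_dvd// E.
  by move=> /(dvdn_leq fg0); rewrite ltnNge Aq.
rewrite -(card_in_imset hinj) (leq_trans (max_card _))//.
by rewrite card_ffun !card_ord.
Qed.

(** Serves to enclose a set of diameter [D] in an open ball at an arbitrarily small cost in
    weight. *)
Lemma exp_radius_near (n : nat) (D e : R) : 0 <= D -> 0 < e ->
  exists2 r, D < r & (r / 2) ^+ n <= (D / 2) ^+ n + e.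
Proof.
move=> D0 e0.
have : {for D, continuous (fun x : R => (x / 2) ^+ n)}.
  apply: (@continuous_comp _ _ _ (fun x : R => x / 2) (fun x : R => x ^+ n)).
    exact: mulrr_continuous.
  exact: exprn_continuous.
move=> /cvgrPdist_le/(_ e e0)/nbhs_ballP[r /= r0 rP].
exists (D + r / 2); first by rewrite ltrDl divr_gt0.
have := rP (D + r / 2); rewrite /ball/= opprD addrA subrr sub0r normrN.
rewrite gtr0_norm ?divr_gt0// ltr_pdivrMr// ltr_pMr// ltr1n => /(_ isT).
by rewrite ler_distlC => /andP[_].
Qed.

(** * The unit sphere has positive measure *)

Section positivity.
Context {m : nat} (N : 'rV[R]_m.+1 -> R) (a b : R).
Hypothesis NP : equivalent_norm N a b.

Let b0 : 0 < b.
Proof.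
case: (NP) => _ _ a0 _.
have := le_trans (gauge_ge NP (const_mx 1)) (gauge_le NP (const_mx 1)).
rewrite ler_pM2r; first by move=> ab; rewrite (lt_le_trans a0).
rewrite normr_gt0; apply/eqP => /rowP/(_ 0)/eqP.
by rewrite !mxE oner_eq0.
Qed.

(** The grid occupies the part of one face of the unit cube with nonnegative coordinates, which is
    enough for a lower bound. *)
Let gridpoint (Q : nat) (f : {ffun 'I_m -> 'I_Q.+1}) : 'rV[R]_m.+1 :=
  \row_i (if unlift 0 i is Some j then (f j)%:R / Q%:R else 1).

Let gridpoint_norm Q f : (0 < Q)%N -> `|@gridpoint Q f| = 1.
Proof.
move=> Q0; apply/eqP; rewrite eq_le; apply/andP; split.
  apply: norm_le_coord => // i; rewrite mxE; case: unliftP => [j _|_]; last first.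
    by rewrite normr1.
  rewrite ger0_norm ?divr_ge0// ler_pdivrMr ?ltr0n// mul1r ler_nat.
  by rewrite -ltnS ltn_ord.
rewrite (le_trans _ (le_coord_norm (gridpoint f) 0))//.
by rewrite mxE unlift_none normr1.
Qed.

(** The radial images are within [2 r] of each other. Coordinate 0 then compares [1 / p] with
    [1 / q], and another coordinate compares [u / p] with [v / q]; clearing [p <= b] yields
    [u - v <= 4 b r]. *)
Let grid_close Q (f g : {ffun 'I_m -> 'I_Q.+1}) (r : R) (x : 'rV[R]_m.+1) :
  (0 < Q)%N -> `|(N (gridpoint f))^-1 *: gridpoint f - x| <= r ->
  `|(N (gridpoint g))^-1 *: gridpoint g - x| <= r ->
  forall j, (f j - g j <= Num.truncn (4 * b * r * Q%:R))%N.
Proof.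
move=> Q0 fr gr j; set p := N (gridpoint f) in fr *; set q := N (gridpoint g) in gr *.
have Npos h : 0 < N (@gridpoint Q h).
  by rewrite (gauge_gt0 NP)// -normr_gt0 gridpoint_norm.
have p0 : 0 < p by exact: Npos.
have q0 : 0 < q by exact: Npos.
have pb : p <= b by rewrite (le_trans (gauge_le NP _))// gridpoint_norm// mulr1.
have r0 : 0 <= r by exact: le_trans fr.
have fg : `|p^-1 *: gridpoint f - q^-1 *: gridpoint g| <= 2 * r.
  rewrite -(subrKA x) (le_trans (ler_normD _ _))//.
  rewrite (mulr_natl r 2) mulr2n lerD//.
  by rewrite distrC.
have c0 := le_trans (le_coord_norm _ 0) fg.
have cj := le_trans (le_coord_norm _ (lift 0 j)) fg.
rewrite !mxE unlift_none !mulr1 in c0; rewrite !mxE liftK in cj.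
set u := (f j)%:R / _ in cj; set v := (g j)%:R / _ in cj.
have v1 : `|v| <= 1.
  by rewrite -(gridpoint_norm g Q0) (le_trans _ (le_coord_norm _ (lift 0 j)))// mxE liftK.
have uv : u - v <= 4 * b * r.
  have -> : u - v = p * ((p^-1 * u - q^-1 * v) - v * (p^-1 - q^-1)).
    by field; rewrite ?gt_eqF.
  rewrite (le_trans (ler_norm _))// normrM (gtr0_norm p0).
  apply: (@le_trans _ _ (p * (4 * r))); last first.
    by rewrite -[leRHS]mulrA [leRHS]mulrCA ler_wpM2r// mulr_ge0.
  rewrite ler_wpM2l ?(ltW p0)// (le_trans (ler_normB _ _))//.
  have -> : 4 * r = 2 * r + 2 * r by ring.
  rewrite lerD// normrM (le_trans (ler_piMl _ v1))//.
rewrite truncn_ge_nat; last by rewrite !mulr_ge0// ltW.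
have [fg'|/ltnW] := leqP (g j) (f j); last first.
  by rewrite -subn_eq0 => /eqP->; rewrite !mulr_ge0// ltW.
rewrite natrB// -ler_pdivrMr ?ltr0n// mulrBl.
exact: uv.
Qed.

(* A ball of radius [r] contains the radial images of at most
   [(4 b r Q + 1) ^ m] of the [(Q + 1) ^ m] grid points of mesh [1 / Q] on a face
   of the unit cube. *)
Let grid_count (n : nat) (x : nat -> 'rV[R]_m.+1) (r : nat -> R) :
  (forall k, 0 < r k) ->
  [set x | N x = 1] `<=` [set y | exists2 k, (k < n)%N & `|y - x k| <= r k] ->
  1 <= \sum_(k < n) (8 * b * r k) ^+ m.
Proof.
move=> r0 cover.
(* So fine a grid that every [4 b r_k Q] is at least 1; rounding up then costs at most a factor 2,
   whence the constant 8. *)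
pose Q := (\sum_(k < n) (Num.truncn (4 * b * r k)^-1).+1).+1.
have Q0 : 0 < Q%:R :> R by rewrite ltr0n.
have Qr (k : 'I_n) : 1 <= 4 * b * r k * Q%:R.
  have br0 : 0 < 4 * b * r k by rewrite !mulr_gt0.
  rewrite -ler_pdivrMl// mulr1 ltW// (lt_le_trans (truncnS_gt _))// ler_nat.
  by rewrite /Q (bigD1 k)//= leqW// leq_addr.
pose p f := (N (@gridpoint Q f))^-1 *: gridpoint f.
have pcov f : exists k : 'I_n, `|p f - x k| <= r k.
  have f0 : 0 < N (@gridpoint Q f).
    by rewrite (gauge_gt0 NP)// -normr_gt0 gridpoint_norm.
  have [|k kn pk] := cover (p f); last by exists (Ordinal kn).
  by rewrite /= (gaugeZ NP) gtr0_norm ?invr_gt0// mulVf// gt_eqF.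
have [kap kapP] := choice pcov.
have count : (Q.+1 ^ m <= \sum_(k < n) (Num.truncn (4 * b * r k * Q%:R)).+1 ^ m)%N.
  have -> : (Q.+1 ^ m = \sum_(f : {ffun 'I_m -> 'I_Q.+1}) 1)%N.
    by rewrite sum1_card card_ffun !card_ord.
  rewrite (partition_big kap predT)//=; apply: leq_sum => k _.
  rewrite sum1_card -cardsE card_window// => f g.
  rewrite !inE => /eqP fk /eqP gk.
  by apply: (@grid_close _ _ _ _ (x k)) => //; [rewrite -fk|rewrite -gk]; exact: kapP.
have Qm0 : 0 < Q%:R ^+ m :> R by rewrite exprn_gt0.
rewrite -(ler_pM2r Qm0) mul1r mulr_suml.
apply: (@le_trans _ _ (Q.+1 ^ m)%:R).
  by rewrite natrX lerXn2r ?nnegrE ?ler_nat.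
apply: (@le_trans _ _
    (\sum_(k < n) (Num.truncn (4 * b * r k * Q%:R)).+1 ^ m)%:R).
  by rewrite ler_nat.
rewrite natr_sum; apply: ler_sum => k _.
rewrite natrX -exprMn lerXn2r ?nnegrE ?mulr_ge0 ?(ltW b0) ?(ltW (r0 k))//.
have := Qr k; set z := 4 * b * r k * Q%:R => z1.
rewrite (_ : 8 * b * r k * Q%:R = z + z); last by rewrite /z; ring.
rewrite -addn1 natrD lerD// truncn_le.
exact: le_trans z1.
Qed.

(** Otherwise there is a cover of small total weight; its members are enclosed in open balls, and a
    finite subcover contradicts [grid_count]. *)
Lemma hausdorff_unit_sphere_gt0 : (0 < m)%N ->
  (0 < hausdorff m [set x | N x = 1%R])%E.
Proof.
move=> m0; rewrite lt_neqAle hausdorff_ge0 andbT eq_sym; apply/eqP => H0.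
set V := unit_ball_volume R m; have V0 : 0 < V by exact: unit_ball_volume_gt0.
have Cb0 : 0 < (16 * b) ^+ m by rewrite exprn_gt0// mulr_gt0.
(* One [e] bounds the weights and another the enlargement of the radii, so the sum in [grid_count]
   is below [2 e (16 b) ^ m = 1 / 2]. *)
pose e := (4 * (16 * b) ^+ m)^-1.
have e0 : 0 < e by rewrite invr_gt0 mulr_gt0.
have c0 : (hausdorff_content m 1 [set x | N x = 1%R] < (V * e)%:E)%E.
  rewrite (le_lt_trans (hausdorff_content_le _ _ ltr01))// H0 lte_fin.
  exact: mulr_gt0.
have [_ [U [SU dU] <-] sumU] := ereal_inf_lt c0.
pose D k := if U k == set0 then 0 else fine (diameter (U k)).
have D0 k : 0 <= D k.
  by rewrite /D; case: ifPn => // /set0P U0; rewrite fine_ge0// diameter_ge0.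
have Dfin k : U k !=set0 -> (D k)%:E = diameter (U k).
  move=> U0; rewrite /D; case: ifPn => [/eqP U1|_].
    by move: U0; rewrite U1 => -[].
  rewrite fineK// ge0_fin_numE ?diameter_ge0//.
  by rewrite (le_lt_trans (dU k))// ltry.
(* For empty [U k] the right-hand side is 0 because [0 < m]. *)
have wD k : hausdorff_weight m (U k) = (V * (D k / 2) ^+ m)%:E.
  rewrite /hausdorff_weight /D; case: ifPn => [_|//].
  by rewrite mul0r expr0n -[m == 0%N]negbK -lt0n m0/= mulr0.
have ek0 k : 0 < e / (2 ^ k.+1)%:R.
  by rewrite divr_gt0// ltr0n expn_gt0.
have [r rP] : {r : nat -> R & forall k, D k < r k /\
    (r k / 2) ^+ m <= (D k / 2) ^+ m + e / (2 ^ k.+1)%:R}.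
  apply: (@choice _ _ (fun k r => D k < r /\
    (r / 2) ^+ m <= (D k / 2) ^+ m + e / (2 ^ k.+1)%:R)) => k.
  by have [r Dr rm] := exp_radius_near m (D0 k) (ek0 k); exists r.
have r0 k : 0 < r k by rewrite (le_lt_trans (D0 k))//; case: (rP k).
(* An arbitrary default point when [U k] is empty; its ball is then paid for by the enlargement term
   alone. *)
pose x k : 'rV[R]_m.+1 := get (U k).
have Ur k y : U k y -> `|y - x k| < r k.
  move=> Uy; apply: le_lt_trans (norm_le_l2norm _) _.
  have Ux : U k (x k) by apply: getI Uy.
  have := l2norm_le_diameter Uy Ux; rewrite -Dfin; last by exists y.
  by rewrite lee_fin => /le_lt_trans; apply; case: (rP k).
have cS : compact [set x | N x = 1].
  apply: bounded_closed_compact.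
    case: (NP) => _ _ a0 _.
    exists a^-1; split; first exact: num_real.
    move=> t ta y /= Ny; rewrite (le_trans _ (ltW ta))//.
    by rewrite -[leRHS]mul1r ler_pdivlMr// -Ny mulrC (gauge_ge NP).
  apply: (@closed_comp _ _ N [set t | t = 1]); last exact: closed_eq.
  by move=> y _; exact: (continuous_gauge NP).
move: cS; rewrite compact_cover => /(_ nat setT (fun k => ball (x k) (r k))).
case=> [k _|y Ny|F _ SF].
- exact: ball_open.
- have [k _ Uky] := SU y Ny; exists k => //.
  by rewrite mx_norm_ball /ball_/= distrC; exact: Ur.
pose n := (\max_(k <- finmap.enum_fset F) k).+1.
have : 1 <= \sum_(k < n) (8 * b * r k) ^+ m.
  apply: (@grid_count n x r r0) => y Ny /=.
  have [k /= kF] := SF y Ny.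
  rewrite mx_norm_ball /ball_/= distrC => /ltW yk; exists k => //.
  by rewrite /n ltnS (leq_bigmax_seq k).
apply/negP; rewrite -ltNge.
have rb k : (8 * b * r k) ^+ m <= (16 * b) ^+ m * ((D k / 2) ^+ m + e / (2 ^ k.+1)%:R).
  have -> : 8 * b * r k = 16 * b * (r k / 2) by field.
  by rewrite exprMn ler_wpM2l ?(ltW Cb0)//; case: (rP k).
apply: (@le_lt_trans _ _ (\sum_(k < n) (16 * b) ^+ m *
    ((D k / 2) ^+ m + e / (2 ^ k.+1)%:R))).
  by apply: ler_sum => k _; exact: rb.
rewrite -mulr_sumr big_split/=.
have s1 : \sum_(k < n) (D k / 2) ^+ m < e.
  rewrite -(ltr_pM2l V0) mulr_sumr -lte_fin (le_lt_trans _ sumU)//.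
  rewrite -sumEFin (eq_bigr (fun k : 'I_n => hausdorff_weight m (U k))); last first.
    by move=> k _; rewrite wD.
  rewrite -(big_mkord xpredT (fun k => hausdorff_weight m (U k))).
  by apply: nneseries_lim_ge => k _ _; exact: hausdorff_weight_ge0.
have s2 : \sum_(k < n) e / (2 ^ k.+1)%:R <= e.
  rewrite -mulr_sumr -[leRHS]mulr1 ler_wpM2l ?(ltW e0)//.
  suff -> : \sum_(k < n) (2 ^ k.+1)%:R^-1 = 1 - (2 ^ n)%:R^-1 :> R.
    by rewrite gerBl invr_ge0.
  elim: (n) => [|l IH]; first by rewrite big_ord0 expn0 invr1 subrr.
  rewrite big_ord_recr/= IH expnS natrM.
  have p0 : (2 ^ l)%:R != 0 :> R by rewrite pnatr_eq0 -lt0n expn_gt0.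
  by field.
rewrite -ltr_pdivlMl// mulr1; apply: (lt_le_trans (ltr_leD s1 s2)).
rewrite /e invfM -mulrDl ler_piMl ?invr_ge0 ?(ltW Cb0)//.
lra.
Qed.

End positivity.
End hausdorff_unit_sphere.

(** * Fourier decay and hyperplanes *)

Section decaying_level_sets.
Context {dsp : measure_display} {T : measurableType dsp} {R : realType}.
Variables (mu : {measure set T -> \bar R}) (D : set T).
Hypotheses (mD : measurable D) (Doo : (mu D < +oo)%E).

Lemma integrable_cos (f : T -> R) : measurable_fun D f ->
  mu.-integrable D (EFin \o (fun x => cos (f x))).
Proof.
move=> mf; apply: measurable_bounded_integrable => //.
  apply: (measurableT_comp _ mf).
  by apply: continuous_measurable_fun; exact: continuous_cos.
exists 1; split; first exact: num_real.
by move=> M M1 x _ /=; rewrite (le_trans _ (ltW M1))// cos_max.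
Qed.

Lemma integrable_sin (f : T -> R) : measurable_fun D f ->
  mu.-integrable D (EFin \o (fun x => sin (f x))).
Proof.
move=> mf; apply: measurable_bounded_integrable => //.
  apply: (measurableT_comp _ mf).
  by apply: continuous_measurable_fun; exact: continuous_sin.
exists 1; split; first exact: num_real.
by move=> M M1 x _ /=; rewrite (le_trans _ (ltW M1))// sin_max.
Qed.

(** The squared modulus of [\sum_(j < n) e^(i j t)], that is [n] times the usual Fejer kernel. *)
Definition fejer (n : nat) (t : R) : R :=
  \sum_(j < n) \sum_(k < n) cos ((j%:R - k%:R) * t).

Lemma fejer_ge0 n t : 0 <= fejer n t.
Proof.
have -> : fejer n t =
    (\sum_(j < n) cos (j%:R * t)) ^+ 2 + (\sum_(j < n) sin (j%:R * t)) ^+ 2.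
  rewrite !expr2 !mulr_suml -big_split; apply: eq_bigr => j _ /=.
  rewrite !mulr_sumr -big_split; apply: eq_bigr => k _ /=.
  by rewrite mulrBl cosB.
by rewrite addr_ge0// sqr_ge0.
Qed.

Lemma fejer0 n : fejer n 0 = (n ^ 2)%:R.
Proof.
rewrite /fejer (eq_bigr (fun=> n%:R)) => [|j _].
  by rewrite sumr_const card_ord -mulrnA mulnn.
rewrite (eq_bigr (fun=> 1)) => [|k _]; last by rewrite mulr0 cos0.
by rewrite sumr_const card_ord.
Qed.

(* Wiener's argument: the Fejer kernel of [T f] dominates [n ^ 2] times the
   indicator function of [f = 0], and its integral is [n * mu D] up to
   off-diagonal terms, all small when [T] is large. *)
Lemma decaying_level_null (f : T -> R) : measurable_fun D f ->
  (forall e : R, 0 < e -> exists t : R, forall k : nat, (0 < k)%N ->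
    `|\int[mu]_(x in D) cos (k%:R * t * f x)| <= e) ->
  mu (D `&` [set x | f x = 0]) = 0.
Proof.
move=> mf decay; set E := _ `&` _.
have mE : measurable E.
  rewrite (_ : E = D `&` f @^-1` [set 0])//.
  by apply: mf => //; exact: measurable_set1.
have ED : (mu E <= mu D)%E by apply: le_measure; rewrite ?inE//; exact: subIsetl.
have Efin : mu E \is a fin_num.
  by rewrite ge0_fin_numE ?measure_ge0// (le_lt_trans ED).
have Dfin : mu D \is a fin_num by rewrite ge0_fin_numE ?measure_ge0.
set z := fine (mu E); set M := fine (mu D).
have z0 : 0 <= z by rewrite fine_ge0.
have M0 : 0 <= M by rewrite fine_ge0.
suff zle0 : z <= 0.
  by rewrite -(fineK Efin) -/z; congr EFin; apply/eqP; rewrite eq_le zle0.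
rewrite leNgt; apply/negP => {}z0.
have z4 : 0 < z / 4 by rewrite divr_gt0.
have [t tdecay] := decay _ z4.
(* The estimates below give [n ^ 2 z <= n M + n ^ 2 z / 4], which is incompatible with
   [4 M < n z]. *)
pose n := (Num.truncn (4 * M / z)).+1.
have n0 : 0 < n%:R :> R by rewrite ltr0n.
have nM : 4 * M < n%:R * z by rewrite -ltr_pdivrMr// truncnS_gt.
pose I (j k : nat) := \int[mu]_(x in D) cos ((j%:R - k%:R) * (t * f x)).
have mft (c : R) : measurable_fun D (fun x => c * (t * f x)).
  by apply: measurable_funM => //; apply: measurable_funM.
have Iint (c : R) : mu.-integrable D (EFin \o (fun x => cos (c * (t * f x)))).
  exact: integrable_cos.
have mF : measurable_fun D (fun x => (fejer n (t * f x))%:E).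
  apply/measurable_EFinP; apply: measurable_sum => j; apply: measurable_sum => k.
  by have /integrableP[/measurable_EFinP] := Iint (j%:R - k%:R).
have H1 : ((n ^ 2)%:R%:E * mu E <= \int[mu]_(x in D) (fejer n (t * f x))%:E)%E.
  rewrite -integral_cst//.
  rewrite (eq_integral (fun x => (fejer n (t * f x))%:E)); last first.
    by move=> x; rewrite inE => -[_ /= ->]; rewrite mulr0 fejer0.
  apply: ge0_subset_integral => //.
  - by move=> x _; rewrite lee_fin fejer_ge0.
  - exact: subIsetl.
have H2 : (\int[mu]_(x in D) (fejer n (t * f x))%:E =
    (\sum_(j < n) \sum_(k < n) I j k)%:E)%E.
  rewrite (eq_integral (fun x => \sum_(j < n)
      \sum_(k < n) (cos ((j%:R - k%:R) * (t * f x)))%:E)%E); last first.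
    by move=> x _; rewrite /fejer -sumEFin; apply: eq_bigr => j _; rewrite -sumEFin.
  rewrite integral_sum//; last first.
    move=> j; apply: integrable_sum => // k _; exact: Iint.
  rewrite -sumEFin; apply: eq_bigr => j _.
  rewrite integral_sum//; last by move=> k; exact: Iint.
  rewrite -sumEFin; apply: eq_bigr => k _.
  rewrite /I /Rintegral fineK//; apply: integrable_fin_num => //; exact: Iint.
have Ioff (j k : nat) : (k < j)%N -> I j k <= z / 4.
  move=> kj; rewrite (le_trans (ler_norm _))//.
  rewrite /I; under eq_Rintegral do rewrite -natrB ?(ltnW kj)// mulrA.
  by apply: tdecay; rewrite subn_gt0.
have Isym (j k : nat) : I j k = I k j.
  by apply: eq_Rintegral => x _; rewrite -cosN -mulNr opprB.
have Idiag (j : nat) : I j j = M.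
  rewrite /I; under eq_Rintegral do rewrite subrr mul0r cos0.
  by rewrite Rintegral_cst// mul1r.
have H3 : \sum_(j < n) \sum_(k < n) I j k <= n%:R * M + (n ^ 2)%:R * (z / 4).
  rewrite -mulnn natrM -mulrA -mulrDr.
  rewrite -[in leRHS](card_ord n) mulr_natl -sumr_const; apply: ler_sum => j _.
  rewrite (bigD1 j)//= Idiag lerD2l.
  apply: (@le_trans _ _ (\sum_(k < n | k != j) z / 4)).
    apply: ler_sum => k kj; have [jk|jk|/val_inj E'] := ltngtP j k.
    - by rewrite Isym Ioff.
    - exact: Ioff.
    - by rewrite E' eqxx in kj.
  rewrite card_ord mulr_natl -[X in _ <= _ *+ X](card_ord n) -sumr_const.
  by rewrite [leRHS](bigID (fun k : 'I_n => k == j))/= lerDr sumr_ge0// => *; rewrite ltW.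
have : (n ^ 2)%:R * z <= n%:R * M + (n ^ 2)%:R * (z / 4).
  rewrite (le_trans _ H3)// -lee_fin -H2 (le_trans _ H1)//.
  by rewrite EFinM fineK.
rewrite -mulnn natrM -!mulrA -mulrDr ler_pM2l// => H.
have nz : 0 < n%:R * z by rewrite mulr_gt0.
by move: H; rewrite mulrA; lra.
Qed.

End decaying_level_sets.

(** * Hyperplane sections of a surface with decaying Fourier transform *)

Section surface_decay.
Context {R : realType} {d : nat}.
Local Notation X := (caratheodory_type (hausdorff_outer R d d.-1)).

(** Rays generate the Borel sets, and their preimages are complements of sublevel sets. *)
Lemma surface_measurable_fun (g : 'rV[R]_d -> R) (L : R) : 0 < L ->
  (forall x y, `|g x - g y| <= L * `|x - y|) ->
  measurable_fun setT (g : X -> R).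
Proof.
move=> L0 gL; apply: (@measurability _ _ _ _ _ _ (@RGenOInfty.G R)).
  exact: RGenOInfty.measurableE.
move=> _ [_ [t ->] <-]; rewrite setTI.
rewrite (_ : _ @^-1` _ = ~` [set x | g x - t <= 0]); last first.
  apply/seteqP; split=> x /=; rewrite in_itv/= andbT subr_le0.
    by move=> tg; apply/negP; rewrite -ltNge.
  by move=> /negP; rewrite -ltNge.
apply: measurableC; apply: (@caratheodory_sublevel _ _ _ (fun x => g x - t) L) => //.
move=> x y; rewrite opprB addrA subrK (le_trans (gL _ _))//.
by rewrite ler_wpM2l ?(ltW L0)// norm_le_l2norm.
Qed.

Lemma surface_measurable_dotv (w : 'rV[R]_d) :
  measurable_fun setT ((fun x => dotv x w) : X -> R).
Proof.
apply: (@surface_measurable_fun _ (d%:R * `|w| + 1)).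
  by rewrite ltr_wpDl// mulr_ge0.
move=> x y; rewrite -dotvBl (le_trans (ler_norm_dotv _ _))//.
by rewrite mulrAC ler_wpM2r// lerDl.
Qed.

Lemma normc_le_Re_Im (z : R[i]) (c : R) : `|z| <= (c%:C)%C ->
  `|complex.Re z| <= c /\ `|complex.Im z| <= c.
Proof.
case: z => x y; rewrite normc_def lecR/= => H; split; apply: le_trans H;
  rewrite -sqrtr_sqr ler_wsqrtr// ?lerDl ?lerDr sqr_ge0//.
Qed.

(** Wiener's argument for [dotv x w - b]. The shift by [b] multiplies the transform by a phase, so
    the cosine integral combines its real and imaginary parts with coefficients at most 1 in
    absolute value, each part contributing [e / 2]. *)
Lemma surface_decay_null (K D : set 'rV[R]_d) (w : 'rV[R]_d) (b : R) :
  boundary K = D -> measurable (D : set X) ->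
  (@surface_measure R d D < +oo)%E ->
  (forall e : R, 0 < e -> exists2 t : R, 0 < t & forall k : nat, (0 < k)%N ->
     `|surface_fourier K ((k%:R * t) *: w)| <= (e%:C)%C) ->
  @surface_measure R d (D `&` [set x | dotv x w = b]) = 0%E.
Proof.
move=> KD mD Doo decay.
have mw : measurable_fun (D : set X) ((fun x => dotv x w) : X -> R).
  by apply: measurable_funTS; exact: surface_measurable_dotv.
rewrite (_ : [set x | _] = [set x : X | dotv (x : 'rV[R]_d) w - b = 0]); last first.
  apply/seteqP; split=> x /=; first by move=> ->; rewrite subrr.
  by move/eqP; rewrite subr_eq0 => /eqP.
apply: (decaying_level_null mD Doo (f := fun x : X => dotv (x : 'rV[R]_d) w - b)).
  by apply: measurable_funB.
move=> e e0; have e2 : 0 < e / 2 by rewrite divr_gt0.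
have [t t0 ht] := decay _ e2; exists (2 * pi * t) => k k0.
have [] := normc_le_Re_Im (ht k k0).
set s := (k%:R * t) *: w; rewrite /surface_fourier /surface_integral KD/= => HRe HIm.
pose c := k%:R * (2 * pi * t) * b.
have mc : measurable_fun (D : set X) ((fun x => 2 * pi * dotv x s) : X -> R).
  rewrite (_ : (fun _ => _) = (fun x : X => dotv (x : 'rV[R]_d) ((2 * pi) *: s))).
    by apply: measurable_funTS; exact: surface_measurable_dotv.
  by apply/funext => x; rewrite dotvZr.
have icos := integrable_cos mD Doo mc; have isin := integrable_sin mD Doo mc.
have -> : \int[surface_measure]_(x in D) cos (k%:R * (2 * pi * t) * (dotv x w - b)) =
    \int[surface_measure]_(x in D)
      (cos c * cos (2 * pi * dotv x s) + sin c * sin (2 * pi * dotv x s)).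
  apply: eq_Rintegral => x _; rewrite -cosB.
  by rewrite -[LHS]cosN; congr cos; rewrite /c /s dotvZr; ring.
have iZ (g : X -> R) (r : R) : (@surface_measure R d).-integrable D (EFin \o g) ->
    (@surface_measure R d).-integrable D (EFin \o (fun x => r * g x)).
  move=> ig; rewrite (_ : EFin \o _ = (fun x => r%:E * (EFin \o g) x)%E).
    exact: integrableZl.
  by apply/funext => x /=; rewrite EFinM.
rewrite RintegralD//; [|exact: iZ|exact: iZ].
rewrite !RintegralZl//.
have -> : \int[surface_measure]_(x in D) cos (2 * pi * dotv x s) =
    \int[surface_measure]_(x in D) cos (- (2 * pi * dotv x s)).
  by apply: eq_Rintegral => x _; rewrite cosN.
have -> : \int[surface_measure]_(x in D) sin (2 * pi * dotv x s) =
    - \int[surface_measure]_(x in D) sin (- (2 * pi * dotv x s)).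
  apply/eqP; rewrite eq_sym eqr_oppLR -mulN1r -RintegralZl//; apply/eqP.
  by apply: eq_Rintegral => x _; rewrite sinN mulN1r.
rewrite (le_trans (ler_normD _ _))//.
rewrite [leRHS]splitr lerD// normrM.
  by rewrite (le_trans (ler_piMl _ (cos_max _))).
by rewrite normrN (le_trans (ler_piMl _ (sin_max _))).
Qed.

End surface_decay.

(** * Bodies with decaying Fourier transform *)

Section normK_theory.
Context {R : realType} {d : nat}.
Variable K : set 'rV[R]_d.
Hypotheses (K_bounded : bounded_set K)
  (K_convex : convex_set (K : set (convex_lmodType 'rV[R]_d)))
  (K_sym : forall x, K x -> K (- x)) (K_int : K° !=set0).
Implicit Types x y : 'rV[R]_d.

Let dilation x : set R := [set t : R | 0 < t /\ [set t *: y | y in K] x].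

Let convK x y (t : R) : K x -> K y -> 0 <= t <= 1 ->
  K (t *: x + (1 - t) *: y).
Proof.
move=> Kx Ky /andP[t0 t1].
have := K_convex (Itv01 t0 t1) (mem_set Kx) (mem_set Ky).
by rewrite inE.
Qed.

(** [x] is the midpoint of [k + x] and [- (k - x)], both in [K] when [k] is an interior point and
    [x] is small. *)
Let ballK : exists2 r : R, 0 < r & forall x, `|x| < r -> K x.
Proof.
have [k] := K_int; rewrite /interior => /nbhs_ballP[r /= r0 rK].
exists r => // x xr.
have K1 : K (k + x).
  by apply: rK; rewrite mx_norm_ball /ball_/= opprD addrA subrr sub0r normrN.
have K2 : K (- (k - x)).
  by apply: K_sym; apply: rK; rewrite mx_norm_ball /ball_/= opprB addrCA subrr addr0.
have h : 0 <= (2^-1 : R) <= 1 by rewrite invr_ge0 ler0n/= invf_le1// ler1n.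
have := convK K1 K2 h; congr K.
by apply/rowP => i; rewrite !mxE; field.
Qed.

Let boundK : exists2 M : R, 0 < M & forall x, K x -> `|x| <= M.
Proof.
have [M [_ KM]] := K_bounded; exists (`|M| + 1); first by rewrite ltr_wpDl.
by move=> x Kx; apply: KM => //; rewrite (le_lt_trans (ler_norm _))// ltrDl.
Qed.

Let K0 : K 0.
Proof. by have [r r0] := ballK; apply; rewrite normr0. Qed.

Let has_inf_dilation x : has_inf (dilation x).
Proof.
split; last by exists 0 => t [/ltW].
have [r r0 rK] := ballK.
have t0 : 0 < 2 * `|x| / r + 1 by rewrite ltr_wpDl// divr_ge0 ?(ltW r0)// mulr_ge0.
exists (2 * `|x| / r + 1); split => //.
exists ((2 * `|x| / r + 1)^-1 *: x); last by rewrite scalerA divff ?gt_eqF// scale1r.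
apply: rK; rewrite normrZ gtr0_norm ?invr_gt0// ltr_pdivrMl//.
rewrite mulrDl divfK ?gt_eqF// mul1r.
by have := normr_ge0 x; lra.
Qed.

Let normK_le x (t : R) : dilation x t -> normK K x <= t.
Proof. by move=> xt; apply: ge_inf => //; case: (has_inf_dilation x). Qed.

Let normK_ge0 x : 0 <= normK K x.
Proof.
apply: lb_le_inf; first by case: (has_inf_dilation x).
by move=> t [/ltW].
Qed.

(** Admissible dilation factors are upward closed, by convexity and [K 0]. *)
Let normK_lt x (t : R) : normK K x < t -> dilation x t.
Proof.
move=> xt; have [s [s0 [y Ky sy]] st] := inf_lt (proj1 (has_inf_dilation x)) xt.
have t0 : 0 < t by exact: lt_trans st.
split => //; exists ((s / t) *: y); last first.
  by rewrite scalerA mulrCA divff ?gt_eqF// mulr1.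
have st1 : 0 <= s / t <= 1.
  by rewrite divr_ge0 ?(ltW s0) ?(ltW t0)//= ler_pdivrMr// mul1r ltW.
by have := convK Ky K0 st1; rewrite scaler0 addr0.
Qed.

Let normKD x y : normK K (x + y) <= normK K x + normK K y.
Proof.
apply/ler_addgt0Pr => e e0; have e2 : 0 < e / 2 by rewrite divr_gt0.
have [t0 [u Ku tu]] := @normK_lt x (normK K x + e / 2) ltac:(by rewrite ltrDl).
have [s0 [v Kv sv]] := @normK_lt y (normK K y + e / 2) ltac:(by rewrite ltrDl).
set t := (X in X *: u) in tu t0; set s := (X in X *: v) in sv s0.
have -> : normK K x + normK K y + e = t + s by rewrite addrACA -splitr.
have ts0 : 0 < t + s by rewrite addr_gt0.
apply: normK_le; split => //.
exists (t / (t + s) *: u + (1 - t / (t + s)) *: v).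
  apply: convK => //.
  by rewrite divr_ge0 ?(ltW t0) ?(ltW ts0)//= ler_pdivrMr// mul1r lerDl ltW.
rewrite -tu -sv; apply/rowP => i; rewrite !mxE; field.
by rewrite gt_eqF.
Qed.

Let normKN x : normK K (- x) = normK K x.
Proof.
congr inf; apply/seteqP; split=> t [t0 [y Ky ty]]; split => //;
  exists (- y); rewrite ?scalerN ?ty ?opprK//; exact: K_sym.
Qed.

Let normK0 : normK K 0 = 0.
Proof.
apply/eqP; rewrite eq_le normK_ge0 andbT; apply/ler_addgt0Pr => e e0.
by rewrite add0r; apply: normK_le; split => //; exists 0 => //; rewrite scaler0.
Qed.

Let normKZ_le x (s : R) : 0 < s -> normK K (s *: x) <= s * normK K x.
Proof.
move=> s0; apply/ler_addgt0Pr => e e0.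
have es : normK K x < normK K x + e / s by rewrite ltrDl divr_gt0.
have [t0 [u Ku tu]] := normK_lt es.
have -> : s * normK K x + e = s * (normK K x + e / s).
  by rewrite mulrDr mulrCA divff ?gt_eqF// mulr1.
apply: normK_le; split; first by rewrite mulr_gt0.
by exists u => //; rewrite -scalerA tu.
Qed.

Let normKZ (s : R) x : normK K (s *: x) = `|s| * normK K x.
Proof.
wlog s0 : s / 0 < s.
  move=> H; have [s0|s0|->] := ltgtP s 0.
  - by rewrite -normKN -scaleNr H ?oppr_gt0// normrN.
  - exact: H.
  - by rewrite scale0r normK0 normr0 mul0r.
rewrite gtr0_norm//; apply/eqP; rewrite eq_le normKZ_le//=.
rewrite -ler_pdivlMl//.
rewrite -[X in normK K X <= _]scale1r -(mulVf (lt0r_neq0 s0)) -scalerA.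
by rewrite normKZ_le// invr_gt0.
Qed.

Lemma normK_equivalent : exists a b, equivalent_norm (normK K) a b.
Proof.
have [r r0 rK] := ballK; have [M M0 KM] := boundK.
(* [K] lies in the closed ball of radius [M] and contains the open ball of radius [r]; the factor 2
   keeps the rescaled point strictly inside the latter. *)
exists M^-1, (2 / r); split => //; first by rewrite invr_gt0.
move=> x; apply/andP; split.
  apply: lb_le_inf; first by case: (has_inf_dilation x).
  move=> t [t0 [y Ky <-]]; rewrite normrZ gtr0_norm// ler_pdivrMl//.
  by rewrite mulrC ler_wpM2r ?(ltW t0)// KM.
have [->|x0] := eqVneq x 0; first by rewrite normK0 normr0 mulr0.
have nx0 : 0 < `|x| by rewrite normr_gt0.
have t0 : 0 < 2 / r * `|x| by rewrite mulr_gt0// divr_gt0.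
apply: normK_le; split => //.
exists ((2 / r * `|x|)^-1 *: x); last by rewrite scalerA divff ?gt_eqF// scale1r.
apply: rK; rewrite normrZ gtr0_norm ?invr_gt0// ltr_pdivrMl//.
by rewrite mulrAC divfK ?gt_eqF//; lra.
Qed.

(** Small radial moves show that the closure is the closed unit ball of the gauge and the interior
    the open one: inwards for the closure, outwards for the interior. *)
Lemma boundary_normK : boundary K = [set x | normK K x = 1].
Proof.
have [a [b NP]] := normK_equivalent.
have small x (e : R) : 0 < e -> exists2 t, 0 < t < 1 & `|t *: x| < e.
  move=> e0; have M0 : 0 < `|x| + 1 by rewrite ltr_wpDl.
  pose t := Num.min (2^-1) (e / (`|x| + 1) / 2).
  have t0 : 0 < t by rewrite lt_min invr_gt0 ltr0n/= !divr_gt0.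
  exists t; first by rewrite t0/= gt_min invf_lt1// ltr1n.
  rewrite normrZ (gtr0_norm t0).
  apply: (@le_lt_trans _ _ (e / (`|x| + 1) / 2 * (`|x| + 1))).
    by rewrite ler_pM ?(ltW t0)// ?ge_min ?lexx ?orbT// lerDl.
  by rewrite mulrAC divfK ?gt_eqF// ltr_pdivrMr// ltr_pMr// ltr1n.
have ltK x : normK K x < 1 -> K x.
  by move=> /normK_lt[_ [y Ky <-]]; rewrite scale1r.
have Kle x : K x -> normK K x <= 1.
  by move=> Kx; apply: normK_le; split => //; exists x => //; rewrite scale1r.
have closureE : closure K = [set x | normK K x <= 1].
  apply/seteqP; split=> x.
    have cl : closed [set x | normK K x <= 1].
      apply: (@closed_comp _ _ (normK K) [set t | t <= 1]); last exact: closed_le.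
      by move=> y _; exact: (continuous_gauge NP).
    by move=> /(closureS Kle); rewrite -(proj1 (closure_id _) cl).
  move=> /= x1 B /nbhs_ballP[e /= e0 eB].
  have [t /andP[t0 t1] tx] := small x e e0.
  exists (x - t *: x); split; last first.
    by apply: eB; rewrite mx_norm_ball /ball_/= opprB addrCA subrr addr0.
  apply: ltK; rewrite -[X in X - _]scale1r -scalerBl normKZ gtr0_norm ?subr_gt0//.
  by rewrite (le_lt_trans (ler_piMr _ x1)) ?subr_ge0 ?(ltW t1)// gtrBl.
have interiorE : K° = [set x | normK K x < 1].
  apply/seteqP; split=> x.
    rewrite /interior => /nbhs_ballP[e /= e0 eK].
    have [t /andP[t0 t1] tx] := small x e e0.
    have : K (x + t *: x).
      by apply: eK; rewrite mx_norm_ball /ball_/= opprD addrA subrr sub0r normrN.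
    move=> /Kle; rewrite -[X in X + _]scale1r -scalerDl normKZ.
    have t2 : 0 < 1 + t by rewrite addr_gt0.
    rewrite gtr0_norm// -ler_pdivlMl// mulr1 => /le_lt_trans; apply.
    by rewrite invf_lt1// ltrDl.
  move=> /= x1; rewrite /interior; apply: (@filterS _ _ _ [set y | normK K y < 1]).
    by move=> y /=; exact: ltK.
  apply: open_nbhs_nbhs; split => //.
  apply: (@open_comp _ _ (normK K) [set t | t < 1]); last exact: open_lt.
  by move=> y _; exact: (continuous_gauge NP).
rewrite /boundary closureE interiorE; apply/seteqP; split=> x /=.
  by move=> [x1 /negP]; rewrite -leNgt => x2; apply/eqP; rewrite eq_le x1.
by move=> ->; split => //; rewrite ltxx.
Qed.

End normK_theory.

(** * Fourier decay excludes separated distance sets *)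

Section not_separated.
Context {R : realType}.

Lemma well_distributed_dense d (S : set 'rV[R]_d) : well_distributed S ->
  exists C, dense_within C S.
Proof.
move=> [C C0 SC]; exists C => a; have [x Sx xa] := SC a; exists x => //.
apply: norm_le_coord => [|i]; first exact: ltW.
have /andP[x1 x2] := xa i; rewrite !mxE ger0_norm ?subr_ge0//.
by rewrite lerBlDl.
Qed.

Lemma distance_set_gap d (S K : set 'rV[R]_d) :
  separated_for Num.norm (distance_set K S) -> exists2 c : R, 0 < c &
    forall x x' y y', S x -> S x' -> S y -> S y' ->
      normK K (x - y) != normK K (x' - y') ->
      c <= `|normK K (x - y) - normK K (x' - y')|.
Proof.
move=> [c c0 cS]; exists c => // x x' y y' Sx Sx' Sy Sy' /eqP xy.
apply: cS => //; first by exists x => //; exists y.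
by exists x' => //; exists y'.
Qed.

(** Countable subadditivity, with slices indexed through an injection of [W] into the naturals;
    indices outside its image give empty slices. *)
Lemma hausdorff_slices_eq0 d s (A W : set 'rV[R]_d) : countable W ->
  A `<=` \bigcup_(w in W) [set x | dotv x w = 1] ->
  (forall w, W w -> hausdorff s (A `&` [set x | dotv x w = 1%R]) = 0%E) ->
  hausdorff s A = 0%E.
Proof.
move=> /countable_injP[f finj] AW W0.
pose B n := A `&` [set x | exists w, [/\ W w, f w = n & dotv x w = 1]].
have AB : A `<=` \bigcup_n B n.
  by move=> x Ax; have [w Ww wx] := AW x Ax; exists (f w) => //; split => //; exists w.
apply/eqP; rewrite eq_le hausdorff_ge0 andbT.
apply: (le_trans (le_hausdorff s AB)).
apply: (le_trans (hausdorff_sigma_subadditive s B)).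
rewrite eseries0// => n _ _.
have [[w [Ww fw]]|nw] := pselect (exists w, W w /\ f w = n).
  apply/eqP; rewrite eq_le hausdorff_ge0 andbT -(W0 _ Ww).
  apply: le_hausdorff => x [Ax [v [Wv fv vx]]]; split => //=.
  by rewrite -(finj v w) ?inE// fv.
rewrite (_ : B n = set0) ?hausdorff0//; apply/seteqP; split=> x // [_ [w [Ww fw _]]].
by apply: nw; exists w.
Qed.

(** Convexity and [gamma 0 = 0] give [gamma tau <= tau * gamma 1] for [tau] in [[0, 1]];
    monotonicity extends the bound to smaller arguments. *)
Lemma convex_gauge_small (C : R) (gamma : R -> R) (e : R) : 0 < C -> 0 < e ->
  convex_function ([set t : R | 0 <= t] : set (convex_lmodType R^o)) gamma ->
  {in [set t : R | 0 <= t] &, {homo gamma : s t / s <= t}} -> gamma 0 = 0 ->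
  exists2 tau, 0 < tau & forall s, 0 <= s <= tau -> C * gamma s <= e.
Proof.
move=> C0 e0 gconv gmono g0.
have g1 : 0 <= gamma 1 by rewrite -g0 gmono ?inE/= ?ler01.
have D0 : 0 < C * gamma 1 + e by rewrite ltr_wpDl// mulr_ge0// ltW.
pose tau := e / (C * gamma 1 + e).
have tau0 : 0 < tau by exact: divr_gt0.
have tau1 : tau <= 1 by rewrite ler_pdivrMr// mul1r lerDr mulr_ge0// ltW.
exists tau => // s /andP[s0 stau].
have gs : gamma s <= gamma tau.
  by apply: gmono => //; rewrite inE//= ltW.
have gtau : gamma tau <= tau * gamma 1.
  have I1 : (1 : R) \in [set t : R | 0 <= t] by rewrite inE/= ler01.
  have I0 : (0 : R) \in [set t : R | 0 <= t] by rewrite inE/=.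
  have : gamma (tau * 1 + (1 - tau) * 0) <= tau * gamma 1 + (1 - tau) * gamma 0.
    exact: (gconv (Itv01 (ltW tau0) tau1) 1 0 I1 I0).
  by rewrite g0 !mulr0 !addr0 mulr1.
rewrite (le_trans (ler_wpM2l (ltW C0) (le_trans gs gtau)))//.
rewrite /tau mulrCA -mulrA ger_pMr// -ler_pdivlMl ?invr_gt0// invrK mulr1.
by rewrite lerDl ltW.
Qed.

Lemma not_separated_of_decay d (S K : set 'rV[R]_d) (C : R) (gamma : R -> R) :
  (2 <= d)%N -> well_distributed S -> bounded_set K ->
  convex_set (K : set (convex_lmodType 'rV[R]_d)) ->
  (forall x, K x -> K (- x)) -> K° !=set0 ->
  0 < C -> convex_function ([set t : R | 0 <= t] : set (convex_lmodType R^o)) gamma ->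
  {in [set t : R | 0 <= t] &, {homo gamma : s t / s <= t}} -> gamma 0 = 0 ->
  (forall xi : 'rV[R]_d, xi != 0 ->
    `|surface_fourier K xi| <= ((C * gamma ((l2norm xi)^-1))%:C)%C) ->
  ~ separated_for Num.norm (distance_set K S).
Proof.
case: d S K => [|[|m]]// S K _ S_wd Kb Kc Ks Ki C0 gconv gmono g0 decay.
have [a [b NP]] := normK_equivalent Kb Kc Ks Ki.
have KE := boundary_normK Kb Kc Ks Ki.
have [CS dS] := well_distributed_dense S_wd.
move=> /distance_set_gap[c c0 sepS].
pose W := [set w | gapped_dual (normK K) S c w /\
  exists2 u, u != 0 & dotv w u = normK K u].
have cW : countable W := gapped_dual_attained_countable NP dS c0.
have H0 := hausdorff_unit_sphere_gt0 NP isT.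
have Hoo := hausdorff_unit_sphere_lty NP.
have b1 : 0 < `|b| + 1 by rewrite ltr_wpDl.
have mN : measurable ([set x | normK K x = 1] :
    set (caratheodory_type (hausdorff_outer R m.+2 m.+1))).
  have mf : measurable_fun setT
      (normK K : caratheodory_type (hausdorff_outer R m.+2 m.+1) -> R).
    apply: (surface_measurable_fun b1) => x y.
    rewrite (le_trans (gauge_lipschitz NP _ _))// ler_wpM2r//.
    by rewrite (le_trans (ler_norm _))// lerDl.
  by have := mf measurableT _ (measurable_set1 1); rewrite setTI.
suff : hausdorff m.+1 [set x | normK K x = 1%R] = 0%E.
  by move=> H1; move: H0; rewrite H1 ltxx.
apply: (hausdorff_slices_eq0 cW).
  move=> x /= Nx; have [w gw wx] := gapped_dual_attained NP dS sepS x.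
  exists w; last by rewrite /= dotvC wx.
  split => //; exists x => //; apply/eqP => x0.
  by move: Nx; rewrite x0 (gauge0 NP) => /esym/eqP; rewrite oner_eq0.
move=> w [_ [u u0 wu]].
have w0 : w != 0.
  apply/eqP => w0; have := gauge_gt0 NP u0.
  by rewrite -wu w0 /dotv big1 ?ltxx// => i _; rewrite mxE mul0r.
have lw0 : 0 < l2norm w by rewrite sqrtr_gt0 dotvv_gt0.
apply: (@surface_decay_null R m.+2 K _ w 1 KE mN Hoo).
move=> e e0; have [tau tau0 tauP] := convex_gauge_small C0 e0 gconv gmono g0.
have t0 : 0 < (tau * l2norm w)^-1 by rewrite invr_gt0 mulr_gt0.
(* The frequency for [k] has length [k / tau], whose inverse is at most [tau] for every [k >= 1]. *)
exists (tau * l2norm w)^-1 => // k k0.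
have k0' : 0 < k%:R :> R by rewrite ltr0n.
apply: (le_trans (decay _ _)).
  by rewrite scaler_eq0 negb_or w0 mulf_neq0// gt_eqF.
rewrite lecR; apply: tauP; rewrite invr_ge0 sqrtr_ge0/=.
rewrite l2normZ gtr0_norm ?mulr_gt0//.
have -> : (k%:R / (tau * l2norm w) * l2norm w)^-1 = k%:R^-1 * tau.
  by field; rewrite !gt_eqF.
by rewrite ler_piMl ?(ltW tau0)// invf_le1// ler1n.
Qed.

End not_separated.

(** * Random rotations *)

Section rotations.
Context {R : realType}.

Lemma dotvE d (x y : 'rV[R]_d) : dotv x y = (x *m y^T) 0 0.
Proof. by rewrite mxE; apply: eq_bigr => i _; rewrite mxE. Qed.

Lemma dotv_mulmx d (x y : 'rV[R]_d) (A : 'M[R]_d) :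
  dotv x (y *m A^T) = dotv (x *m A) y.
Proof. by rewrite !dotvE trmx_mul trmxK mulmxA. Qed.

Lemma dotv_orthogonal d (x : 'rV[R]_d) (A : 'M[R]_d) : A *m A^T = 1%:M ->
  dotv (x *m A) (x *m A) = dotv x x.
Proof. by move=> AA; rewrite -dotv_mulmx -mulmxA AA mulmx1. Qed.

(** The factor [d] comes from passing through the Euclidean norm, which [A] preserves. *)
Lemma dense_within_rotate d (S : set 'rV[R]_d) (C : R) (A : 'M[R]_d) :
  A *m A^T = 1%:M -> dense_within C S ->
  dense_within (d%:R * C) (rotate A S).
Proof.
move=> AA dS a; have [x Sx xa] := dS (a *m A).
exists (x *m A^T); first by exists x.
rewrite -[a in `|_ - a|]mulmx1 -AA mulmxA -mulmxBl.
apply: (le_trans (norm_le_l2norm _)); rewrite /l2norm dotv_orthogonal; last first.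
  by rewrite trmxK mulmx1C.
by rewrite (le_trans (l2norm_le_norm _))// ler_wpM2l.
Qed.

Lemma gapped_rotate d (S : set 'rV[R]_d) (c : R) (A : 'M[R]_d) w :
  gapped c (rotate A S) w -> gapped c S (w *m A).
Proof.
move=> gw x x' Sx Sx'; rewrite -dotv_mulmx mulmxBl; apply: gw.
  by exists x.
by exists x'.
Qed.

Definition plane_rotation m (c s : R) : 'M[R]_(2 + m) :=
  block_mx (\matrix_(i, j) if i == j then c else if i == 0 then s else - s)
    0 0 1%:M.

Lemma plane_rotation_SO m (c s : R) : c ^+ 2 + s ^+ 2 = 1 ->
  @SO R (2 + m) (plane_rotation m c s).
Proof.
move=> cs; rewrite /SO/= /plane_rotation; split.
  rewrite tr_block_mx mulmx_block !trmx0 trmx1 !mul0mx !mulmx0 mulmx1 !addr0 add0r.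
  rewrite scalar_mx_block; congr block_mx.
  apply/matrixP => i j; rewrite !mxE !big_ord_recl big_ord0 !mxE.
  by case: i => [[|[|//]] ?]; case: j => [[|[|//]] ?];
    rewrite /= -?cs ?mulr1n ?mulr0n; ring.
rewrite det_ublock det1 mulr1 (expand_det_row _ 0) !big_ord_recl big_ord0.
by rewrite /cofactor !det_mx11 !mxE /= -[RHS]cs /bump/=; ring.
Qed.

(** If [(x, y)] are the first two coordinates of [w], their inner product with those of the image is
    [(x ^ 2 + y ^ 2) c]. *)
Lemma plane_rotation_inj m (c s c' s' : R) (w : 'rV[R]_(2 + m)) :
  w 0 (lshift m 0) != 0 ->
  w *m plane_rotation m c s = w *m plane_rotation m c' s' -> c = c'.
Proof.
move=> w0 E.
have coord i : (w *m plane_rotation m c s) 0 i = (w *m plane_rotation m c' s') 0 i.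
  by rewrite E.
have E0 := coord (lshift m 0); have E1 := coord (lshift m (lift 0 0)).
move: E0 E1.
rewrite /plane_rotation -[w]hsubmxK !mul_row_block !mulmx0 !addr0 !row_mxEl !mxE.
rewrite !big_ord_recl !big_ord0 !mxE /=.
set x := w 0 _; set y := w 0 _ => E0 E1.
have x0 : x != 0.
  by apply: contraNneq w0 => <-; rewrite /x; apply/eqP; congr (w 0 _); apply: val_inj.
have D0 : x ^+ 2 + y ^+ 2 != 0.
  by rewrite gt_eqF// ltr_pwDl ?sqr_ge0// exprn_even_gt0.
apply: (mulfI D0).
transitivity (x * (x * c + (y * - s + 0)) + y * (x * s + (y * c + 0))); first by ring.
by rewrite E0 E1; ring.
Qed.

(** Orthogonal matrices of either determinant: polynomial equations define a closed, hence Borel,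
    set. *)
Definition transporters d (w t : 'rV[R]_d) : set 'M[R]_d :=
  [set B | w *m B = t /\ B *m B^T = 1%:M].

Lemma closed_transporters d (w t : 'rV[R]_d) : closed (transporters w t).
Proof.
have -> : transporters w t =
    \bigcap_(j in setT) [set B : 'M[R]_d | \sum_k w 0 k * B k j = t 0 j] `&`
    \bigcap_(ij in setT) [set B : 'M[R]_d |
      \sum_k B ij.1 k * B ij.2 k = (1%:M : 'M[R]_d) ij.1 ij.2].
  apply/seteqP; split=> [B [wB BB]|B [wB BB]]; split.
  - by move=> j _ /=; rewrite -wB mxE.
  - move=> [i j] _ /=; rewrite -BB mxE.
    by apply: eq_bigr => k _; rewrite mxE.
  - by apply/rowP => j; rewrite mxE; exact: wB.
  - apply/matrixP => i j; rewrite -(BB (i, j) I) mxE /=.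
    by apply: eq_bigr => k _; rewrite mxE.
have cc (i j : 'I_d) : continuous (fun B : 'M[R]_d => B i j).
  exact: coord_continuous.
apply: closedI; [apply: closed_bigI => j _|apply: closed_bigI => -[i j] _].
  apply: (@closed_comp _ _ (fun B : 'M[R]_d => \sum_k w 0 k * B k j) [set x | x = t 0 j]).
    move=> B _; move: B; apply: continuous_big => [|k _ B].
      exact: add_continuous.
    apply: (@cvgM _ _ _ (nbhs_filter B) (cst (w 0 k))); first exact: cvg_cst.
    exact: cc.
  exact: closed_eq.
apply: (@closed_comp _ _ (fun B : 'M[R]_d => \sum_k B i k * B j k)
    [set x | x = (1%:M : 'M[R]_d) i j]).
  move=> B _; move: B; apply: continuous_big => [|k _ B].
    exact: add_continuous.
  by apply: (@cvgM _ _ _ (nbhs_filter B)); exact: cc.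
exact: closed_eq.
Qed.

Lemma measurable_transporters d (w t : 'rV[R]_d) :
  measurable (transporters w t : set (@borel_mx R d)).
Proof.
rewrite -[transporters w t]setCK; apply: measurableC.
by apply: sub_sigma_algebra; rewrite openC; exact: closed_transporters.
Qed.

Lemma transporters_mulmx d (w t : 'rV[R]_d) (A : 'M[R]_d) : A *m A^T = 1%:M ->
  [set A *m B | B in transporters w t] = transporters (w *m A^T) t.
Proof.
move=> AA; have AA' : A^T *m A = 1%:M by exact: mulmx1C.
apply/seteqP; split=> [_ [B [wB BB] <-]|B [wB BB]].
  split; first by rewrite -mulmxA (mulmxA A^T) AA' mul1mx.
  by rewrite trmx_mul mulmxA -(mulmxA A) BB mulmx1.
exists (A^T *m B); last by rewrite mulmxA AA mul1mx.
split; first by rewrite mulmxA.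
by rewrite trmx_mul trmxK mulmxA -(mulmxA A^T) BB mulmx1.
Qed.

(* Left translates of [transporters w t] by rotations moving [w] are disjoint. *)
Lemma haar_transporters_eq0 m (mu : probability (@borel_mx R (2 + m)) R)
    (w t : 'rV[R]_(2 + m)) :
  is_haar_SO mu -> w 0 (lshift m 0) != 0 ->
  mu (transporters w t : set (@borel_mx R (2 + m))) = 0%E.
Proof.
move=> [_ haar] w0.
(* The rational parametrisation of the circle provides infinitely many rotations with distinct
   cosines. *)
pose c (k : nat) : R := (1 - k%:R ^+ 2) / (1 + k%:R ^+ 2).
pose s (k : nat) : R := - (2 * k%:R / (1 + k%:R ^+ 2)).
have D0 (k : nat) : 0 < 1 + k%:R ^+ 2 :> R by rewrite ltr_pwDl// sqr_ge0.
have cs k : c k ^+ 2 + s k ^+ 2 = 1.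
  by rewrite /c /s; field; rewrite gt_eqF.
pose G k := plane_rotation m (c k) (s k).
have GT k : (G k)^T = plane_rotation m (c k) (- s k).
  rewrite /G /plane_rotation tr_block_mx !trmx0 trmx1; congr block_mx.
  apply/matrixP => i j; rewrite !mxE eq_sym; case: eqP => // /eqP.
  by case: i => [[|[|//]] ?]; case: j => [[|[|//]] ?] //=; rewrite opprK.
have cinj k l : c k = c l -> k = l.
  move=> /eqP; rewrite /c eqr_div ?lt0r_neq0// => /eqP E.
  have : k%:R ^+ 2 = l%:R ^+ 2 :> R by nra.
  by move=> /eqP; rewrite eqrXn2// eqr_nat => /eqP.
have GSO k : @SO R (2 + m) (G k) by exact: plane_rotation_SO.
pose F k : set (@borel_mx R (2 + m)) := transporters (w *m (G k)^T) t.
have mF k : measurable (F k) by exact: measurable_transporters.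
have muF k : mu (F k) = mu (transporters w t : set (@borel_mx R (2 + m))).
  rewrite /F -transporters_mulmx; last by case: (GSO k).
  exact: (haar _ _ (GSO k) (measurable_transporters w t)).
have tF : trivIset setT F.
  apply/trivIsetP => k l _ _ kl; apply/seteqP; split=> // B [[B1 BB] [B2 _]].
  move/eqP: kl; apply; apply: cinj.
  apply: (@plane_rotation_inj m _ (- s k) _ (- s l) w w0).
  rewrite -!GT -[LHS]mulmx1 -BB mulmxA B1.
  by rewrite -[RHS]mulmx1 -BB [RHS]mulmxA B2.
set z := mu (transporters w t : set _).
have zfin : z \is a fin_num by apply: fin_num_measure; exact: measurable_transporters.
have z0 : (0 <= z)%E by exact: measure_ge0.
have nz n : n%:R * fine z <= 1.
  rewrite -lee_fin EFinM fineK//.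
  have : (mu (\big[setU/set0]_(k < n) F k) <= 1)%E.
    by apply: probability_le1; apply: bigsetU_measurable.
  rewrite (measure_bigsetU mu mF tF) (eq_bigr (fun=> z)); last by move=> k _; exact: muF.
  by rewrite -[z]fineK// sumEFin sumr_const card_ord -EFinM mulr_natl.
rewrite -(fineK zfin); congr EFin; apply/eqP; rewrite eq_le fine_ge0// andbT.
rewrite leNgt; apply/negP => fz0.
have := nz (Num.truncn (fine z)^-1).+1; rewrite leNgt => /negP; apply.
by rewrite -ltr_pdivrMr// mul1r truncnS_gt.
Qed.

(** Proportional vectors of equal nonzero Euclidean length differ by a sign. *)
Lemma gapped_sphere_countable d (S : set 'rV[R]_d) (C c r : R) :
  dense_within C S -> 0 < c -> 0 < r ->
  countable [set t | gapped c S t /\ dotv t t = r].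
Proof.
move=> dS c0 r0.
have l0 : 0 < Num.sqrt r by rewrite sqrtr_gt0.
have d1 : 0 < d%:R + 1 :> R by rewrite ltr_wpDl.
apply: (gapped_countable (m := Num.sqrt r / (d%:R + 1)) (M := Num.sqrt r) dS c0).
- exact: divr_gt0.
- move=> t [gt tr]; split => //.
    rewrite ler_pdivrMr// -tr mulrC (le_trans (l2norm_le_norm t))//.
    by rewrite ler_wpM2r// lerDl.
  by rewrite -tr norm_le_l2norm.
move=> t a [_ tr] [_]; rewrite dotvZl dotvZr tr mulrA -expr2 => /eqP.
rewrite -subr_eq0 -[X in _ - X]mul1r -mulrBl mulf_eq0 (gt_eqF r0) orbF subr_eq0.
by rewrite sqrf_eq1 => /orP[] /eqP->; rewrite ?normrN normr1.
Qed.

Lemma gapped_monotone d (S : set 'rV[R]_d) (c c' : R) w : c' <= c ->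
  gapped c S w -> gapped c' S w.
Proof. by move=> cc' gw x x' Sx Sx' /(gw _ _ Sx Sx'); exact: le_trans. Qed.

Lemma not_separated_ae_rotate d (S K : set 'rV[R]_d)
    (mu : probability (@borel_mx R d) R) :
  (2 <= d)%N -> well_distributed S -> bounded_set K ->
  convex_set (K : set (convex_lmodType 'rV[R]_d)) ->
  (forall x, K x -> K (- x)) -> K° !=set0 -> is_haar_SO mu ->
  {ae mu, forall rho : 'M[R]_d, SO rho ->
      ~ separated_for Num.norm (distance_set K (rotate rho S))}.
Proof.
case: d S K mu => [|[|m]]// S K mu _ S_wd Kb Kc Ks Ki haar.
have [a [b NP]] := normK_equivalent Kb Kc Ks Ki.
have [C dS] := well_distributed_dense S_wd.
pose i0 : 'I_m.+2 := lshift m (0 : 'I_2).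
pose e1 : 'rV[R]_m.+2 := delta_mx 0 i0.
have e1_neq0 : e1 != 0.
  by apply/eqP => /rowP/(_ i0)/eqP; rewrite !mxE !eqxx oner_eq0.
have Ne1 := gauge_gt0 NP e1_neq0.
have b1 : 0 < 2 * `|b| + 1 by rewrite ltr_wpDl// mulr_ge0.
(* Closeness of [p] to [e1] makes the first coordinate of [w] nonzero, so that plane rotations move
   [w]: if it vanished, then [N p = dotv w (p - e1) <= |b| |p - e1|], hence
   [N e1 <= 2 |b| |p - e1|], which is too small. *)
have [p [w [B [pe1 B0 H]]]] := gauge_le_paraboloid NP e1 (divr_gt0 Ne1 b1).
have [wp wN] := paraboloid_slope NP B0 H.
have w0 : w 0 i0 != 0.
  have <- : dotv w e1 = w 0 i0.
    rewrite /dotv (bigD1 i0)//= mxE !eqxx mulr1 big1 ?addr0// => j /negPf ji.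
    by rewrite mxE ji andbF mulr0.
  apply/eqP => we1.
  have h1 := wN (p - e1); rewrite dotvBr wp we1 subr0 in h1.
  have h2 : normK K e1 <= normK K p + normK K (p - e1).
    rewrite -(gaugeN NP (p - e1)) opprB -[X in normK K X <= _](subrK p) addrC.
    exact: (le_trans (gaugeD NP _ _)).
  have h3 : normK K (p - e1) <= `|b| * `|p - e1|.
    by rewrite (le_trans (gauge_le NP _))// ler_wpM2r// ler_norm.
  have h4 : (2 * `|b| + 1) * `|p - e1| <= normK K e1 by rewrite mulrC -ler_pdivlMr.
  have h5 : 0 < `|p - e1|.
    rewrite normr_gt0 subr_eq0; apply: contraTneq Ne1 => pe.
    by rewrite -pe -wp pe we1 ltxx.
  by nra.
have ww0 : 0 < dotv w w.
  by apply: dotvv_gt0; apply: contraNneq w0 => ->; rewrite mxE.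
(* The gap depends on the rotation, so all gaps [1 / (n + 1)] are collected in one countable set. *)
pose W := \bigcup_n [set t | gapped n.+1%:R^-1 S t /\ dotv t t = dotv w w].
have cW : countable W.
  apply: bigcup_countable => // n _; apply: (gapped_sphere_countable dS).
    by rewrite invr_gt0.
  by [].
have /countable_injP[f finj] := cW.
pose A n : set (@borel_mx R m.+2) :=
  [set D | exists t, [/\ W t, f t = n & transporters w t D]].
have A0 n : mu.-negligible (A n).
  have [[t [Wt ft]]|nt] := pselect (exists t, W t /\ f t = n).
    exists (transporters w t); split.
    - exact: measurable_transporters.
    - exact: haar_transporters_eq0.
    - move=> D [u [Wu fu]]; suff -> : u = t by [].
      by apply: finj; rewrite ?inE// fu.
  suff -> : A n = set0 by exact: negligible_set0.
  by apply/seteqP; split=> D // [t [Wt ft _]]; apply: nt; exists t.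
apply: negligibleS (negligible_bigcup A0) => rho.
move=> /= /not_implyP[[rr _]] /contrapT/distance_set_gap[c c0 sepS].
have gw := slope_gapped NP (dense_within_rotate rr dS) B0 sepS H.
exists (f (w *m rho)) => //; exists (w *m rho); split => //.
exists (Num.truncn c^-1) => //; split; last exact: dotv_orthogonal.
apply: gapped_monotone (gapped_rotate gw).
by rewrite -[leRHS]invrK lef_pV2 ?posrE ?invr_gt0 ?ltr0n// ltW// truncnS_gt.
Qed.

End rotations.

Unset Implicit Arguments.

Theorem corollary0p5 (R : realType) (d : nat) (S K : set 'rV[R]_d)
  (hd : (2 <= d)%N)
  (S_wd : well_distributed S)
  (S_sep : separated_for l2norm S)
  (K_bounded : bounded_set K)
  (K_convex : convex_set (K : set (convex_lmodType 'rV[R]_d)))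
  (K_sym : forall x, K x -> K (- x))
  (K_int : K° !=set0) :
  ((exists (C : R) (gamma : R -> R),
      [/\ 0 < C,
          convex_function
            ([set t : R | 0 <= t] : set (convex_lmodType R^o)) gamma,
          {in [set t : R | 0 <= t] &, {homo gamma : s t / s <= t}},
          gamma 0 = 0
        & forall xi : 'rV[R]_d, xi != 0 ->
            `|surface_fourier K xi| <= ((C * gamma ((l2norm xi)^-1))%:C)%C]) ->
    ~ separated_for Num.norm (distance_set K S))
  /\
  (forall mu : probability (@borel_mx R d) R, is_haar_SO mu ->
    {ae mu, forall rho : 'M[R]_d, SO rho ->
      ~ separated_for Num.norm (distance_set K (rotate rho S))}).
Proof.
split=> [[C [gamma [C0 gconv gmono g0 decay]]]|mu haar].
  exact: (not_separated_of_decay hd S_wd K_bounded K_convex K_sym K_int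
    C0 gconv gmono g0 decay).
exact: not_separated_ae_rotate.
Qed.
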